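(* Let $G$ and $H$ be two (nonempty) graphs on disjoint sets of vertices. Then the join $G*H$ is a perfect projectively prime graph. In particular, $$\operatorname{proj-dim}(G*H)=\operatorname{reg}(S(G*H))=|G|+|H|-1$$ (over any field).
   Context: Graphs are finite, without loops or multiple edges; $|G|$ is the number of vertices of $G$. The join $G*H$ is obtained from the disjoint union $G\cup H$ by inserting an edge between any $x\in V(G)$ and any $y\in V(H)$. The subdivision graph $S(G)$ is obtained from $G$ by subdividing each edge exactly once. For a field $\mathbb{k}$ and a graph $G$ on $V$, let $R=\mathbb{k}[V]$ and $I_G=(xy:xy\in E(G))$. Then $\operatorname{proj-dim}_{\mathbb{k}}(G):=\operatorname{proj-dim}(R/I_G)$ and $\operatorname{reg}_{\mathbb{k}}(G):=\operatorname{reg}(R/I_G)=\max\{j-i:\beta_{i,j}(R/I_G)\neq 0\}$; the field is omitted from the notation when it is fixed. A connected graph $G$ is projectively prime over $\mathbb{k}$ if $\operatorname{proj-dim}_{\mathbb{k}}(G-x)<\operatorname{proj-dim}_{\mathbb{k}}(G)$ for every vertex $x\in V(G)$, where $G-x$ is the induced subgraph on $V(G)\setminus\{x\}$. It is perfect projectively prime if it is projectively prime over every field. *)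

(* Defs.v *)
From HB Require Import structures.
From mathcomp Require Import all_boot all_order all_algebra.
From mathcomp Require Import generic_quotient ring_quotient mpoly.
From mathcomp.classical Require Import boolp.

Set Implicit Arguments.
Unset Strict Implicit.
Unset Printing Implicit Defensive.

Import GRing.Theory.
Local Open Scope ring_scope.
Local Open Scope quotient_scope.

(** * Graphs *)

Record sgraph := SGraph {
  vertex :> finType;
  adj : rel vertex;
  adj_sym : ssrbool.symmetric adj;
  adj_irr : irreflexive adj }.
Arguments adj {s} _ _ : rename.

Definition connected_graph (G : sgraph) : Prop :=
  (0 < #|{: G}|)%N /\ forall x y : G, connect adj x y.

Section Join.
Variables G H : sgraph.

Definition join_adj : rel (G + H)%type := fun u v =>
  match u, v with
  | inl x, inl y => adj x y
  | inr x, inr y => adj x y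
  | _, _ => true
  end.

Fact join_adj_sym : ssrbool.symmetric join_adj.
Proof. by move=> [x|x] [y|y] //=; apply: adj_sym. Qed.

Fact join_adj_irr : irreflexive join_adj.
Proof. by move=> [x|x] /=; apply: adj_irr. Qed.

Definition join : sgraph := SGraph join_adj_sym join_adj_irr.
End Join.

Section DelVertex.
Variables (G : sgraph) (x : G).

Definition del_adj : rel {y : G | y != x} := fun u v => adj (val u) (val v).

Fact del_adj_sym : ssrbool.symmetric del_adj.
Proof. by move=> u v; apply: adj_sym. Qed.

Fact del_adj_irr : irreflexive del_adj.
Proof. by move=> u; apply: adj_irr. Qed.

Definition del_vertex : sgraph := SGraph del_adj_sym del_adj_irr.
End DelVertex.

Section Subdivision.
Variable G : sgraph.

Definition is_edge (e : {set G}) : bool :=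
  [exists x, exists y, adj x y && (e == [set x; y])].

(** The new vertex subdividing the edge [e] is [inr e]; it is adjacent to the
    two ends of [e], and these are the only edges. *)
Definition subdiv_adj : rel (G + {e : {set G} | is_edge e})%type := fun u v =>
  match u, v with
  | inl x, inr e => x \in val e
  | inr e, inl x => x \in val e
  | _, _ => false
  end.

Fact subdiv_adj_sym : ssrbool.symmetric subdiv_adj.
Proof. by move=> [x|e] [y|f]. Qed.

Fact subdiv_adj_irr : irreflexive subdiv_adj.
Proof. by case. Qed.

Definition subdivision : sgraph := SGraph subdiv_adj_sym subdiv_adj_irr.
End Subdivision.

(** * The module [R/I] *)

(** The library only gives [{ideal_quot I}] its ring structure. *)
Section QuotientModule.
Variables (R : comNzRingType) (I : idealr R).
Implicit Types u v : {ideal_quot I}.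

Definition quot_scale (a : R) u : {ideal_quot I} := \pi_({ideal_quot I}) a * u.

Fact quot_scaleA a b u : quot_scale a (quot_scale b u) = quot_scale (a * b) u.
Proof. by rewrite /quot_scale mulrA rmorphM. Qed.

Fact quot_scale1 : left_id 1 quot_scale.
Proof. by move=> u; rewrite /quot_scale rmorph1 mul1r. Qed.

Fact quot_scaleDr : right_distributive quot_scale +%R.
Proof. by move=> a u v; rewrite /quot_scale mulrDr. Qed.

Fact quot_scaleDl u : {morph quot_scale^~ u : a b / a + b}.
Proof. by move=> a b; rewrite /quot_scale rmorphD mulrDl. Qed.

HB.instance Definition _ := GRing.Zmodule_isLmodule.Build R {ideal_quot I}
  quot_scaleA quot_scale1 quot_scaleDr quot_scaleDl.
End QuotientModule.

(** * Projective dimension of a module *)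

Section ProjectiveDimension.
Variable R : nzRingType.

Definition surjective (A B : Type) (f : A -> B) : Prop :=
  forall y, exists x, f x = y.

Definition projective (P : lmodType R) : Prop :=
  forall (A B : lmodType R) (f : {linear A -> B}) (g : {linear P -> B}),
    surjective f -> exists h : {linear P -> A}, forall x, f (h x) = g x.

Record proj_resolution (M : lmodType R) := ProjResolution {
  pr_mod : nat -> lmodType R;
  pr_diff : forall i, {linear pr_mod i.+1 -> pr_mod i};
  pr_aug : {linear pr_mod 0%N -> M};
  pr_projective : forall i, projective (pr_mod i);
  pr_aug_surj : surjective pr_aug;
  pr_exact0 : forall x, pr_aug x = 0 <-> exists y, x = pr_diff 0%N y;
  pr_exact : forall i x,
    pr_diff i x = 0 <-> exists y, x = pr_diff i.+1 y }.

Definition proj_dim_le (M : lmodType R) (d : nat) : Prop :=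
  exists P : proj_resolution M,
    forall i, (d < i)%N -> forall x : pr_mod P i, x = 0.

Definition is_proj_dim (M : lmodType R) (d : nat) : Prop :=
  proj_dim_le M d /\ forall e, proj_dim_le M e -> (d <= e)%N.
End ProjectiveDimension.

(** * Graded Betti numbers and regularity *)

Section GradedBetti.
Variables (k : fieldType) (n : nat).
Let R : comNzRingType := {mpoly k[n]}.

(** [gr d] is the set of homogeneous elements of degree [d] of [M]. The [i]-th
    free module is the direct sum of the [R(- gf_deg a)] over the basis elements
    [a : 'I_(gf_rank i)]; differentials act on row vectors on the right.
    Natural-number shifts suffice because [M] is graded in degrees [>= 0]. *)
Record min_graded_free_resolution (M : lmodType R) (gr : nat -> M -> Prop) :=
  MinGradedFreeResolution {
  gf_rank : nat -> nat;
  gf_deg : forall i, 'I_(gf_rank i) -> nat;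
  gf_diff : forall i, 'M[R]_(gf_rank i.+1, gf_rank i);
  gf_aug : {linear 'rV[R]_(gf_rank 0%N) -> M};
  gf_diff_homog : forall i a b,
    gf_diff i a b = 0 \/
    exists2 d, gf_deg a = (gf_deg b + d)%N & gf_diff i a b \is d.-homog;
  gf_aug_homog : forall a, gr (gf_deg a) (gf_aug (delta_mx 0 a));
  gf_aug_surj : surjective gf_aug;
  gf_exact0 : forall x : 'rV_(gf_rank 0%N),
    gf_aug x = 0 <-> exists y : 'rV_(gf_rank 1%N), x = y *m gf_diff 0%N;
  gf_exact : forall i (x : 'rV_(gf_rank i.+1)),
    x *m gf_diff i = 0 <-> exists y : 'rV_(gf_rank i.+2), x = y *m gf_diff i.+1;
  (* minimality: no nonzero constant term in any entry *)
  gf_minimal : forall i a b, (gf_diff i a b)@_0%MM = 0 }.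

Definition is_graded_betti (M : lmodType R) (gr : nat -> M -> Prop)
    (i j beta : nat) : Prop :=
  exists F : min_graded_free_resolution gr,
    beta = #|[set a : 'I_(gf_rank F i) | gf_deg a == j]|.

Definition is_regularity (M : lmodType R) (gr : nat -> M -> Prop)
    (r : int) : Prop :=
  (exists i j beta, [/\ is_graded_betti gr i j beta, beta <> 0%N
                      & r = j%:Z - i%:Z]) /\
  (forall i j beta, is_graded_betti gr i j beta -> beta <> 0%N ->
     j%:Z - i%:Z <= r).
End GradedBetti.

(** * Edge ideals *)

Section EdgeIdeal.
Variables (k : fieldType) (G : sgraph).

Definition vring : comNzRingType := {mpoly k[#|{: G}|]}.

Definition vvar (x : G) : vring := 'X_(enum_rank x).

Definition edge_ideal : {pred vring} := fun p =>
  `[< exists c : G -> G -> vring,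
        p = \sum_x \sum_(y | adj x y) c x y * (vvar x * vvar y) >].

Fact edge_ideal_closed : idealr_closed edge_ideal.
Proof.
split=> [||a p q /asboolP[c ->] /asboolP[d ->]].
- apply/asboolP; exists (fun _ _ => 0).
  by rewrite big1 // => x _; rewrite big1 // => y _; rewrite mul0r.
- apply/asboolP=> -[c /(congr1 (meval (fun _ => 0)))]; rewrite rmorph1.
  rewrite rmorph_sum big1 => [|x _].
    by move=> h; move: (oner_neq0 k); rewrite h eqxx.
  by rewrite rmorph_sum big1 // => y _; rewrite /= !rmorphM /= !mevalXU !mulr0.
- apply/asboolP; exists (fun x y => a * c x y + d x y).
  rewrite mulr_sumr -big_split; apply: eq_bigr => x _ /=.
  rewrite mulr_sumr -big_split; apply: eq_bigr => y _ /=.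
  by rewrite mulrDl !mulrA.
Qed.

HB.instance Definition _ := isIdealr.Build vring edge_ideal edge_ideal_closed.

Definition edge_quot : lmodType vring := {ideal_quot edge_ideal}.

Definition edge_quot_gr (d : nat) (m : edge_quot) : Prop :=
  exists2 p : vring, p \is d.-homog & m = \pi_({ideal_quot edge_ideal}) p.

Definition graph_proj_dim (d : nat) : Prop := is_proj_dim edge_quot d.

Definition graph_reg (r : int) : Prop := is_regularity edge_quot_gr r.
End EdgeIdeal.

Definition projectively_prime (k : fieldType) (G : sgraph) : Prop :=
  connected_graph G /\
  forall x : G, exists d e,
    [/\ graph_proj_dim k (del_vertex x) d, graph_proj_dim k G e & (d < e)%N].

Definition perfect_projectively_prime (G : sgraph) : Prop :=
  forall k : fieldType, projectively_prime k G.

(* Main.v *)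
Require Import Defs.
From HB Require Import structures.
From mathcomp Require Import all_boot all_order all_algebra.
From mathcomp Require Import generic_quotient ring_quotient mpoly.
From mathcomp Require freeg.
From mathcomp.classical Require Import boolp.

(** Both invariants are read off the Koszul homology [T_p(M) = H_p(x; M)] of a
    module on the variables: it vanishes above the projective dimension of [M],
    and, in bidegree [(p, j)], it is nonzero exactly when a minimal graded free
    resolution of [M] has a generator of degree [j] in homological degree [p].

    For a set [T] of vertices let [I_T] be generated by [T] and the edge ideal.
    For a vertex [x] outside [T] with neighbourhood [N(x)] one has
    [I_T : x = I_(T + N(x))] and [I_T + (x) = I_(T + x)], so the long exact
    sequence of multiplication by [x] yields link/deletion inductions.

    Projective dimension. On [n > 0] vertices, [T_n(R/I) = 0] because a squarefree
    monomial ideal other than the maximal ideal has no socle, hence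
    [proj-dim <= n - 1]. For a join,
    [0 -> R/I -> R/(I_G + (H)) + R/(I_H + (G)) -> k -> 0] transports
    [T_n(k) <> 0] to [T_(n-1)(R/I) <> 0].

    Regularity of the subdivision [S] of the join [K]. The upper bound removes
    the vertices of [K] one at a time; one unit is gained because every subdividing
    vertex has two neighbours, and a leaf can only appear after a first deletion. The
    lower bound looks at the squarefree degree supported on the vertices of [K]
    and the edges between [G] and [H], where links, deletions and folds reduce
    the independence complex to a sphere of dimension [|G| + |H| - 2]. *)

Set Implicit Arguments.
Unset Strict Implicit.
Unset Printing Implicit Defensive.

Import Order.TTheory GRing.Theory Num.Theory.
Local Open Scope ring_scope.

(** * Koszul complexes *)

(** Koszul homology enters only through its vanishing. [kvanish] works with chains of [M] modulo a
    submodule [N], so ideals can vary inside one fixed complex. Nonvanishing is proved backwards: an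
    assumed vanishing is transported to a degree where an explicit cycle is visibly not a boundary.
    The grading group is a parameter because three gradings occur: the trivial group ['I_1] for
    projective dimension, whose resolutions are arbitrary and ungraded; the integers for Betti
    numbers; and integer functions on the vertices, where a squarefree degree isolates an induced
    subgraph. [is_graded_betti] asks for some minimal resolution. The lower bound on regularity
    therefore needs one to be constructed, and the upper bound must hold for every one. For
    projective primality, no exact value is computed for [K - x]: the general bound by the number of
    vertices minus one, applied to a graph with one vertex fewer, already lies below the value
    attained by the join. *)

Section Koszul.
Variables (R : comNzRingType) (I : Type) (x : I -> R).
Variables (D : zmodType) (wt : I -> D).

(* The Koszul complex of [M] on the elements [x i], [i] in [s], is built as an
   iterated mapping cone: [kos M (i :: s)] is the cone of multiplication by
   [x i] on [kos M s]. *)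
Fixpoint kos (M : lmodType R) (s : seq I) : lmodType R :=
  if s is _ :: s' then (kos M s' * kos M s')%type : lmodType R else M.

Fixpoint kdiff (M : lmodType R) (s : seq I) : kos M s -> kos M s :=
  match s return kos M s -> kos M s with
  | [::] => fun=> 0
  | i :: s' => fun z => (kdiff z.1 + x i *: z.2, - kdiff z.2)
  end.

Fixpoint kmap (M N : lmodType R) (f : M -> N) (s : seq I) : kos M s -> kos N s :=
  match s return kos M s -> kos N s with
  | [::] => f
  | i :: s' => fun z => (kmap f z.1, kmap f z.2)
  end.

Fixpoint kall (M : lmodType R) (N : M -> Prop) (s : seq I) : kos M s -> Prop :=
  match s return kos M s -> Prop with
  | [::] => N
  | i :: s' => fun z => kall N z.1 /\ kall N z.2
  end.

(* Chains of homological degree [p] and internal degree [d]. *)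
Fixpoint kh (M : lmodType R) (gr : D -> M -> Prop) (s : seq I) (p : nat) (d : D) :
    kos M s -> Prop :=
  match s return kos M s -> Prop with
  | [::] => fun z => if p is 0%N then gr d z else z = 0
  | i :: s' => fun z => kh gr p d z.1 /\
      (if p is p'.+1 then kh gr p' (d - wt i) z.2 else z.2 = 0)
  end.

Definition submod (M : lmodType R) (N : M -> Prop) : Prop :=
  [/\ N 0, forall u v, N u -> N v -> N (u - v) & forall a u, N u -> N (a *: u)].

Definition graded (M : lmodType R) (gr : D -> M -> Prop) : Prop :=
  [/\ forall d, gr d 0,
      forall d u v, gr d u -> gr d v -> gr d (u - v)
    & forall d i u, gr d u -> gr (d + wt i) (x i *: u)].

(* Vanishing of the Koszul homology of [M / N] in bidegree [(p, d)]. *)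
Definition kvanish (M : lmodType R) (gr : D -> M -> Prop) (N : M -> Prop)
    (s : seq I) (p : nat) (d : D) : Prop :=
  forall z : kos M s, kh gr p d z -> kall N (kdiff z) ->
    exists2 w : kos M s, kh gr p.+1 d w & kall N (z - kdiff w).

Definition null (M : lmodType R) : M -> Prop := fun u => u = 0.

Lemma submod_add (M : lmodType R) (N : M -> Prop) u v : submod N -> N u -> N v -> N (u + v).
Proof.
case=> N0 NB _ Nu Nv; rewrite -[v]opprK; apply: (NB) => //.
by rewrite -sub0r; apply: NB.
Qed.

Lemma submod_opp (M : lmodType R) (N : M -> Prop) u : submod N -> N u -> N (- u).
Proof. by case=> N0 NB _ Nu; rewrite -sub0r; apply: NB. Qed.

Section OneModule.
Variable M : lmodType R.
Implicit Types (N : M -> Prop) (gr : D -> M -> Prop) (s : seq I).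

Fact kdiff_linear s : linear (@kdiff M s).
Proof.
elim: s => [|i s IH] a u v /=; first by rewrite scaler0 addr0.
case: u v => u1 u2 [v1 v2] /=; rewrite !IH.
congr (_, _); last by rewrite opprD -scalerN.
rewrite -[RHS]/(a *: (kdiff u1 + x i *: u2) + (kdiff v1 + x i *: v2)).
by rewrite !scalerDr !scalerA [x i * a]mulrC addrACA.
Qed.
HB.instance Definition _ s :=
  GRing.isLinear.Build R (kos M s) (kos M s) _ (@kdiff M s) (@kdiff_linear s).

Lemma kdiffK s (z : kos M s) : kdiff (kdiff z) = 0.
Proof.
elim: s z => [//|i s IH] [a b] /=.
by rewrite linearD linearZ /= linearN /= linearN /= !IH add0r subrr !oppr0.
Qed.

Lemma kall_submod N s : submod N -> submod (@kall M N s).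
Proof.
move=> subN; elim: s => [//|i s [IH0 IHB IHZ]]; split=> [//|u v [? ?] [? ?]|a u [? ?]].
- by split; apply: IHB.
- by split; apply: IHZ.
Qed.

Lemma kall_diff N s (z : kos M s) : submod N -> kall N z -> kall N (kdiff z).
Proof.
move=> subN; elim: s z => [|i s IH] z /=; first by case: subN.
have subK := kall_submod s subN; have [_ _ KZ] := subK.
move=> [z1 z2]; split; last exact/(submod_opp subK)/IH.
exact: (submod_add subK (IH _ z1) (KZ _ _ z2)).
Qed.

Lemma kall_null s (z : kos M s) : kall (@null M) z <-> z = 0.
Proof.
elim: s z => [//|i s IH] [a b] /=; rewrite !IH.
by split=> [[-> ->]//|[-> ->]].
Qed.

Lemma kall_imp N N' s (z : kos M s) :
  (forall u, N u -> N' u) -> kall N z -> kall N' z.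
Proof.
by move=> NN'; elim: s z => [|i s IH] z /=; [apply: NN'|case=> /IH ? /IH].
Qed.

Lemma kall_and N N' s (z : kos M s) :
  kall N z -> kall N' z -> kall (fun u => N u /\ N' u) z.
Proof.
by elim: s z => [//|i s IH] z /= [? ?] [? ?]; split; apply: IH.
Qed.

Section Graded.
Variable gr : D -> M -> Prop.
Hypothesis grM : graded gr.

Lemma kh0 s p d : kh gr p d (0 : kos M s).
Proof.
by elim: s p d => [|i s IH] [|p] d //=; case: grM.
Qed.
Hint Resolve kh0 : core.

Lemma khB s p d (u v : kos M s) : kh gr p d u -> kh gr p d v -> kh gr p d (u - v).
Proof.
elim: s p d u v => [|i s IH] [|p] d u v /=.
- by case: grM => _ + _; apply.
- by move=> -> ->; rewrite subr0.
- by move=> [? e] [? e']; split; rewrite ?e ?e' ?subr0 //; apply: IH.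
- by move=> [? e] [? e']; split; apply: IH.
Qed.

Lemma khN s p d (u : kos M s) : kh gr p d u -> kh gr p d (- u).
Proof. by move=> hu; rewrite -sub0r; apply: khB. Qed.

Lemma khD s p d (u v : kos M s) : kh gr p d u -> kh gr p d v -> kh gr p d (u + v).
Proof. by move=> hu hv; rewrite -[v]opprK; apply/khB/khN. Qed.

Lemma khX s p d i (u : kos M s) : kh gr p d u -> kh gr p (d + wt i) (x i *: u).
Proof.
elim: s p d u => [|j s IH] [|p] d u /=.
- by case: grM => _ _; apply.
- by move=> ->; rewrite scaler0.
- by move=> [? ->]; split; [apply: IH|rewrite scaler0].
- by move=> [? ?]; split; [|rewrite addrAC]; apply: IH.
Qed.

Lemma khX' s p d i (u : kos M s) : kh gr p (d - wt i) u -> kh gr p d (x i *: u).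
Proof. by move=> /(khX i); rewrite subrK. Qed.

Lemma kdiff_kh0 s d (z : kos M s) : kh gr 0 d z -> kdiff z = 0.
Proof.
by elim: s z => [//|i s IH] [a b] /= [/IH -> ->]; rewrite scaler0 linear0 oppr0 addr0.
Qed.

Lemma kh_diff s p d (z : kos M s) : kh gr p.+1 d z -> kh gr p d (kdiff z).
Proof.
elim: s p d z => [|i s IH] p d z /=; first by move=> _; case: p => //; case: grM.
move=> [z1 z2]; split; first by apply: khD; [apply: IH|apply: khX'].
case: p z1 z2 => [|p] z1 z2; first by rewrite (kdiff_kh0 z2) oppr0.
exact/khN/IH.
Qed.

Lemma kh_big s p d (z : kos M s) : (size s < p)%N -> kh gr p d z -> z = 0.
Proof.
elim: s p d z => [|i s IH] [|p] d //= [a b] /= lt_sp [h1 h2].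
by rewrite (IH _ _ a _ h1) 1?(IH _ _ b _ h2) //; apply: ltn_trans lt_sp.
Qed.

Lemma kvanish_big N s p d : submod N -> (size s < p)%N -> kvanish gr N s p d.
Proof.
move=> subN lt_sp z hz _; exists 0; first exact: kh0.
rewrite (kh_big lt_sp hz) linear0 subrr.
by have [] := kall_submod s subN.
Qed.

End Graded.
End OneModule.

Section Functoriality.
Variables (M M' : lmodType R) (f : {linear M -> M'}).

Fact kmap_linear s : linear (@kmap M M' f s).
Proof.
elim: s => [|i s IH] a u v /=; first exact: linearP.
by case: u v => u1 u2 [v1 v2] /=; rewrite !IH.
Qed.
HB.instance Definition _ s :=
  GRing.isLinear.Build R (kos M s) (kos M' s) _ (@kmap M M' f s) (@kmap_linear s).

Lemma kmap_diff s (z : kos M s) : kmap f (kdiff z) = kdiff (kmap f z).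
Proof.
elim: s z => [|i s IH] z /=; first by rewrite linear0.
by rewrite linearD linearN linearZ /= !IH.
Qed.

Lemma kall_map (N : M' -> Prop) s (z : kos M s) :
  kall N (kmap f z) <-> kall (fun u => N (f u)) z.
Proof. by elim: s z => [//|i s IH] z /=; rewrite !IH. Qed.

Lemma kmap_eq0 s (z : kos M s) :
  kmap f z = 0 <-> kall (fun u => f u = 0) z.
Proof. by rewrite -kall_null kall_map. Qed.

Variables (gr : D -> M -> Prop) (gr' : D -> M' -> Prop).

Lemma kmap_kh (e : D) s p d (z : kos M s) :
  (forall d u, gr d u -> gr' (d - e) (f u)) ->
  kh gr p d z -> kh gr' p (d - e) (kmap f z).
Proof.
move=> gf; elim: s p d z => [|i s IH] [|p] d z /=; first exact: gf.
- by move=> ->; rewrite linear0.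
- by move=> [? ->]; split; [apply: IH|rewrite linear0].
- by move=> [? ?]; split; [|rewrite addrAC]; apply: IH.
Qed.

Lemma kmap_kh0 s p d (z : kos M s) :
  (forall d u, gr d u -> gr' d (f u)) -> kh gr p d z -> kh gr' p d (kmap f z).
Proof.
move=> gf; rewrite -[d in kh gr' _ d]subr0; apply: kmap_kh => d' u.
by rewrite subr0; apply: gf.
Qed.

(** The predicate [A] is the condition under which entries lift: it is always true for surjectivity,
    and it is the kernel of the next map for exactness. *)
Lemma kmap_lift (A : M' -> Prop) s p d (z : kos M' s) : graded gr ->
  (forall d u, gr' d u -> A u -> exists2 v, gr d v & u = f v) ->
  kh gr' p d z -> kall A z -> exists2 w, kh gr p d w & z = kmap f w.
Proof.
move=> grM lift; elim: s p d z => [|i s IH] [|p] d z /=; first exact: lift.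
- by move=> -> _; exists 0; rewrite ?linear0.
- case: z => a b /= [ha ->] [Aa _]; have [w hw ->] := IH _ _ _ ha Aa.
  by exists (w, 0); rewrite //= linear0.
- case: z => a b /= [ha hb] [Aa Ab].
  have [w hw ->] := IH _ _ _ ha Aa; have [w' hw' ->] := IH _ _ _ hb Ab.
  by exists (w, w').
Qed.

Hypotheses (gr_graded : graded gr) (gr_f : forall d u, gr d u -> gr' d (f u)).
Hypothesis gr_surj : forall d u, gr' d u -> exists2 v, gr d v & u = f v.

Lemma kmap_surj s p d (z : kos M' s) :
  kh gr' p d z -> exists2 w, kh gr p d w & z = kmap f w.
Proof.
move=> hz; apply: (kmap_lift (A := fun=> True)) => // [d' u /gr_surj //|].
by clear hz; elim: s z => //= i s IH z; split.
Qed.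

(** Here [M'] is [M / ker f], which justifies reading [kvanish] relative to a submodule as the
    vanishing of the homology of a quotient. *)
Lemma kvanish_quotient s p d :
  kvanish gr' (@null M') s p d <-> kvanish gr (fun u => f u = 0) s p d.
Proof.
split=> V z hz.
  move/kmap_eq0=> fz; case: (V (kmap f z)); first exact: kmap_kh0.
    by apply/kall_null; rewrite -kmap_diff.
  move=> w' /kmap_surj[w hw ->] /kall_null e; exists w => //.
  by apply/kmap_eq0; rewrite linearB /= kmap_diff.
move/kall_null; have [u hu ->] := kmap_surj hz; rewrite -kmap_diff => /kmap_eq0 e.
have [w hw /kmap_eq0] := V _ hu e; rewrite linearB /= kmap_diff => e'.
by exists (kmap f w); [apply: kmap_kh0|apply/kall_null].
Qed.

End Functoriality.

Lemma kmap_id (M M' : lmodType R) (f : M -> M') (g : M' -> M) s (z : kos M s) :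
  cancel f g -> kmap g (kmap f z) = z.
Proof. by move=> fK; elim: s z => [//|i s IH] [a b] /=; rewrite !IH. Qed.

(** No differential is involved, so the splitting is done entry by entry. It serves with [c] a
    variable for [U + (x_i)], and with [c = 1], [e = 0] for a sum of two ideals. *)
Lemma ksplit (M : lmodType R) (gr : D -> M -> Prop) (A N N' : M -> Prop) (c : R)
    (e : D) s p d (z : kos M s) : N 0 -> N' 0 -> graded gr ->
  (forall d u, gr d u -> A u -> exists a b,
     [/\ gr d a, N a, gr (d - e) b, N' b & u = a + c *: b]) ->
  kh gr p d z -> kall A z -> exists a b,
    [/\ kh gr p d a, kall N a, kh gr p (d - e) b, kall N' b & z = a + c *: b].
Proof.
move=> N0 N'0 grM split1.
have K0 (N1 : M -> Prop) : N1 0 -> forall s, kall N1 (0 : kos M s).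
  by move=> N10; elim=> //= i s' IH.
elim: s p d z => [|i s IH] [|p] d z /=; first exact: split1.
- by move=> -> _; exists 0, 0; rewrite scaler0 addr0.
- case: z => z1 z2 /= [h1 ->] [A1 _].
  have [a [b [ha Na hb Nb ->]]] := IH _ _ _ h1 A1.
  exists (a, 0), (b, 0); split=> //=; try by split=> //; apply: K0.
  by congr (_, _); rewrite /= scaler0 addr0.
- case: z => z1 z2 /= [h1 h2] [A1 A2].
  have [a [b [ha Na hb Nb ->]]] := IH _ _ _ h1 A1.
  have [a' [b' [ha' Na' hb' Nb' ->]]] := IH _ _ _ h2 A2.
  by exists (a, a'), (b, b'); split=> //=; rewrite addrAC.
Qed.

Lemma kvanish_nullP (M : lmodType R) (gr : D -> M -> Prop) s p d :
  kvanish gr (@null M) s p d <->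
  forall z : kos M s, kh gr p d z -> kdiff z = 0 ->
    exists2 w : kos M s, kh gr p.+1 d w & z = kdiff w.
Proof.
split=> V z hz.
  move/kall_null=> /(V _ hz)[w hw /kall_null/eqP]; rewrite subr_eq0 => /eqP->.
  by exists w.
move/kall_null=> /(V _ hz)[w hw ->]; exists w => //.
by apply/kall_null; rewrite subrr.
Qed.

Lemma kvanish_retract (M M' : lmodType R) (f : {linear M -> M'})
    (g : {linear M' -> M}) (gr : D -> M -> Prop) (gr' : D -> M' -> Prop) s p d :
  cancel f g -> (forall d u, gr d u -> gr' d (f u)) ->
  (forall d u, gr' d u -> gr d (g u)) ->
  kvanish gr' (@null M') s p d -> kvanish gr (@null M) s p d.
Proof.
move=> fK gf gg /kvanish_nullP V; apply/kvanish_nullP => z hz dz.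
have [|w hw e] := V (kmap f z) (kmap_kh0 gf hz).
  by rewrite -kmap_diff dz linear0.
exists (kmap g w); first exact: kmap_kh0 hw.
by rewrite -kmap_diff -e kmap_id.
Qed.

Section Sum.
Variables (M M0 : lmodType R) (gr : D -> M -> Prop) (gr0 : D -> M0 -> Prop).
Variables (A : choiceType) (e : A -> D).
Variables (pr : A -> {linear M -> M0}) (inj : A -> {linear M0 -> M}).
Hypothesis grM : graded gr.
Hypothesis gr_inj : forall a d u, gr0 (d - e a) u -> gr d (inj a u).

Lemma kboundary_sum (L : seq A) s p d (z : kos M s) :
  kall (fun u => u = \sum_(a <- L) inj a (pr a u)) z ->
  (forall a, exists2 w, kh gr0 p (d - e a) w & kmap (pr a) z = kdiff w) ->
  exists2 w, kh gr p d w & z = kdiff w.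
Proof.
move=> zL W.
have {}zL : z = \sum_(a <- L) kmap (inj a) (kmap (pr a) z).
  clear W; elim: s z zL => [//|i s IH] [a b] /= [/IH {1}-> /IH {1}->].
  clear IH; elim: L => [|a0 L IHL]; first by rewrite !big_nil.
  by rewrite !big_cons -IHL.
have {W}/choice[w wP] : forall a, exists w, kh gr0 p (d - e a) w /\ kmap (pr a) z = kdiff w.
  by move=> a; have [w hw ew] := W a; exists w.
have ginjk a q t (v : kos M0 t) d' :
    kh gr0 q (d' - e a) v -> kh gr q d' (kmap (inj a) v).
  move=> h; have := @kmap_kh _ _ (inj a) gr0 gr (- e a) t q (d' - e a) v.
  have eK c : c - - e a = c + e a by rewrite opprK.
  rewrite eK subrK; apply=> // d1 u1 h1; rewrite eK.
  by apply: gr_inj; rewrite addrK.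
exists (\sum_(a <- L) kmap (inj a) (w a)).
  elim: {zL} L => [|a L IH]; first by rewrite big_nil; apply: kh0.
  by rewrite big_cons; apply: khD => //; apply: ginjk; case: (wP a).
rewrite linear_sum {1}zL; apply: eq_bigr => a _.
by rewrite /= -kmap_diff; case: (wP a) => _ ->.
Qed.

(** The index type may be infinite, as for the free module on all elements of a projective module; a
    finite list [L] adapted to each chain is enough. *)
Lemma kvanish_sum s p d :
  (forall a d u, gr d u -> gr0 (d - e a) (pr a u)) ->
  (forall z : kos M s, exists L : seq A,
     kall (fun u => u = \sum_(a <- L) inj a (pr a u)) z) ->
  (forall a, kvanish gr0 (@null M0) s p (d - e a)) ->
  kvanish gr (@null M) s p d.
Proof.
move=> gr_pr fin V; apply/kvanish_nullP => z hz dz.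
have [L zL] := fin z; apply: (kboundary_sum zL) => a.
apply: ((kvanish_nullP _ _ _ _).1 (V a)); first exact: (kmap_kh (gr_pr a) hz).
by rewrite -kmap_diff dz linear0.
Qed.

End Sum.

Lemma kall_all (M : lmodType R) (N : M -> Prop) s (z : kos M s) :
  (forall u, N u) -> kall N z.
Proof. by move=> allN; elim: s z => [|i s IH] z //=; split. Qed.

Lemma kall_kh0 (M : lmodType R) (gr : D -> M -> Prop) (N : M -> Prop) s d
    (z : kos M s) :
  N 0 -> (forall u, gr d u -> N u) -> kh gr 0 d z -> kall N z.
Proof.
move=> N0 grN; elim: s z => [|i s IH] z /=; first exact: grN.
move=> [/IH ? ->]; split=> //; elim: (s) => [//|j t IHt] /=.
by split.
Qed.

Lemma kall_boundary (M : lmodType R) (N : M -> Prop) s (z : kos M s) :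
  submod N -> (forall i u, N (x i *: u)) -> kall N (kdiff z).
Proof.
move=> subN NX; have NXs t i (u : kos M t) : kall N (x i *: u).
  by elim: t u => [|j t IH] u /=; [apply: NX|split; apply: IH].
elim: s z => [|i s IH] z /=; first by case: subN.
have subK := kall_submod s subN.
by split; [apply: (submod_add subK)|apply: (submod_opp subK)].
Qed.

Fixpoint kconst (M : lmodType R) (s : seq I) (u : M) : kos M s :=
  match s return kos M s with [::] => u | i :: s' => (kconst s' u, 0) end.

Lemma kconst_kh (M : lmodType R) (gr : D -> M -> Prop) s d u :
  gr d u -> kh gr 0 d (kconst s u).
Proof. by move=> gu; elim: s. Qed.

Lemma kall_kconst (M : lmodType R) (N : M -> Prop) s u :
  kall N (kconst s u) -> N u.
Proof. by elim: s => [|i s IH] //= [/IH]. Qed.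

(** * Koszul homology from a resolution *)

Section Resolution.
Variables (Q : nat -> lmodType R) (gr : forall p, D -> Q p -> Prop).
Variable g : forall p, {linear Q p.+1 -> Q p}.
Variable s : seq I.
Hypothesis gr_graded : forall p, graded (@gr p).
Hypothesis gr_g : forall p d u, gr d u -> gr d (g p u).
Hypothesis g_complex : forall p u, g p (g p.+1 u) = 0.
Hypothesis g_exact : forall p d u,
  gr d u -> g p u = 0 -> exists2 v, gr d v & u = g p.+1 v.
Hypothesis g_surj : forall d (u : Q 0), gr d u -> exists2 v, gr d v & u = g 0 v.
Hypothesis Q_acyclic : forall p i d, kvanish (@gr p.+1) (@null (Q p.+1)) s i.+1 d.

Let kg_exact p i d (u : kos (Q p.+1) s) : kh (@gr p.+1) i d u ->
  kmap (g p) u = 0 -> exists2 v, kh (@gr p.+2) i d v & u = kmap (g p.+1) v.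
Proof.
move=> hu /kmap_eq0; apply: kmap_lift hu => // d' u' h' e.
exact: g_exact.
Qed.

Let kg_complex p (u : kos (Q p.+2) s) : kmap (g p) (kmap (g p.+1) u) = 0.
Proof.
by elim: s u => [|i s' IH] u /=; [exact: g_complex|rewrite !IH].
Qed.

Let kmap_g_kh p i d (u : kos (Q p.+1) s) :
  kh (@gr p.+1) i d u -> kh (@gr p) i d (kmap (g p) u).
Proof. by apply: kmap_kh0 => *; apply: gr_g. Qed.

Let Q_acyclic' p i d : (0 < p)%N -> kvanish (@gr p) (@null (Q p)) s i.+1 d.
Proof. by case: p. Qed.

(** [Q 0] is the resolved module and [Q p.+1] the [p]-th term of the resolution. The zigzag lowers
    the Koszul degree while climbing the resolution up to [Q (p + i).+1], where degree 0 is reached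
    and the hypothesis applies; acyclicity of the terms brings the solution back. *)
Lemma resolution_lift i p d (u : kos (Q p.+1) s) :
  (forall v : kos (Q (p + i).+1) s, kh (@gr (p + i).+1) 0 d v ->
     exists2 w, kh (@gr (p + i).+1) 1 d w & v = kdiff w) ->
  kh (@gr p.+1) i d u -> kmap (g p) (kdiff u) = 0 ->
  exists v w, [/\ kh (@gr p.+1) i.+1 d v, kh (@gr p.+2) i d w
                & u = kdiff v + kmap (g p.+1) w].
Proof.
elim: i p u => [|i IH] p u.
  rewrite addn0 => C hu _; have [v hv ->] := C _ hu.
  by exists v, 0; split; rewrite ?linear0 ?addr0 //; apply: kh0.
rewrite addnS -addSn => C hu gu.
have [u' hu' e] := kg_exact (kh_diff (gr_graded _) hu) gu.
have [|v [w [hv hw eu']]] := IH _ _ C hu'.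
  by rewrite kmap_diff -e kdiffK.
have [||v' hv' ev'] := (kvanish_nullP _ _ _ _).1 (@Q_acyclic p i d) (u - kmap (g p.+1) v).
- by apply: khB => //; apply: kmap_g_kh.
- by rewrite linearB /= e eu' -kmap_diff linearD /= kg_complex addr0 subrr.
exists v', v; split=> //.
by rewrite -ev' subrK.
Qed.

Lemma resolution_kvanish i d :
  (forall v : kos (Q i.+1) s, kh (@gr i.+1) 0 d v ->
     exists2 w, kh (@gr i.+1) 1 d w & v = kdiff w) ->
  kvanish (@gr 0) (@null (Q 0)) s i d.
Proof.
move=> C; apply/kvanish_nullP => z hz dz.
have [u hu ez] := kmap_surj (gr_graded 1) (@g_surj) hz.
have [|//||v [w [hv hw eu]]] := @resolution_lift i 0 d u.
- by rewrite add0n.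
- by rewrite kmap_diff -ez.
exists (kmap (g 0) v); first exact: kmap_g_kh.
by rewrite ez eu linearD /= kg_complex addr0 kmap_diff.
Qed.

(** The zigzag in the other direction: [p + i] stays fixed while [p] drops to 0, where the assumed
    vanishing for [Q 0] applies. With [i = 0] it turns that vanishing into a statement on single
    elements of a free module. *)
Lemma resolution_descend i p d (u : kos (Q p.+1) s) :
  kvanish (@gr 0) (@null (Q 0)) s (p + i) d ->
  kh (@gr p.+1) i d u -> kmap (g p) (kdiff u) = 0 ->
  ((0 < p)%N -> exists2 u', kh (@gr p) i.+1 d u' & kmap (g p) u = kdiff u') ->
  exists v w, [/\ kh (@gr p.+1) i.+1 d v, kh (@gr p.+2) i d w
                & u = kdiff v + kmap (g p.+1) w].
Proof.
elim: p i u => [|p IH] i u V hu gdu gu.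
  have [w' hw' ew'] := (kvanish_nullP _ _ _ _).1 V (kmap (g 0) u)
    (kmap_g_kh hu) (etrans (esym (kmap_diff _ _)) gdu).
  have [w hw ew] := kmap_surj (gr_graded 1) (@g_surj) hw'.
  have [|| v hv ev] := @kg_exact 0 i d (u - kdiff w).
  - by apply: khB => //; apply: kh_diff.
  - by rewrite linearB /= ew' kmap_diff -ew subrr.
  by exists w, v; split=> //; rewrite -ev addrC subrK.
have [//|u' hu' eu'] := gu.
have gdu' : kmap (g p) (kdiff u') = 0 by rewrite -eu' kg_complex.
have [||//||v [w [hv hw ew]]] := IH i.+1 u'.
- by rewrite addnS -addSn.
- by [].
- move=> p_gt0; apply: ((kvanish_nullP _ _ _ _).1 (@Q_acyclic' p i d p_gt0)).
  + exact: kmap_g_kh.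
  + by rewrite -kmap_diff.
have [||v' hv' ev'] := @kg_exact p.+1 i d (u - kdiff w).
- by apply: khB => //; apply: kh_diff.
- by rewrite linearB /= eu' ew linearD /= kdiffK add0r kmap_diff subrr.
by exists w, v'; split=> //; rewrite -ev' addrC subrK.
Qed.

End Resolution.
End Koszul.

(** * Monomial ideals *)

Section Monomials.
Variables (k : fieldType) (n : nat).
Local Notation R := {mpoly k[n]}.
Implicit Types (m : 'X_{1..n}) (i j c : 'I_n) (s : seq 'I_n).

Definition mpick (P : pred 'X_{1..n}) (p : R) : R :=
  \sum_(m <- msupp p | P m) p@_m *: 'X_[m].

Definition mdivX i (p : R) : R := \sum_(m <- msupp p | (0 < m i)%N) p@_m *: 'X_[m - U_(i)].

Lemma mcoeff_mpick P p m : (mpick P p)@_m = if P m then p@_m else 0.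
Proof.
rewrite raddf_sum /=; under eq_bigr do rewrite mcoeffZ mcoeffX.
have [pm|pm] := boolP (m \in msupp p); last first.
  rewrite memN_msupp_eq0 // if_same big1_seq // => m' /andP[_ m'p].
  by case: eqP => [e|_]; [rewrite -e m'p in pm|rewrite mulr0].
rewrite big_mkcond (bigD1_seq m) ?msupp_uniq //= eqxx mulr1 big1 ?addr0 // => m' ne.
by rewrite (negPf ne) mulr0 if_same.
Qed.

Lemma mcoeff_mdivX i p m : (mdivX i p)@_m = p@_(m + U_(i)).
Proof.
rewrite raddf_sum /=; under eq_bigr do rewrite mcoeffZ mcoeffX.
have E m' : (0 < m' i)%N -> (m' - U_(i) == m)%MM = (m' == m + U_(i))%MM.
  move=> m'i; rewrite -(eqm_add2r U_(i)) submK //.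
  by rewrite lep1mP -lt0n.
have [pm|pm] := boolP ((m + U_(i))%MM \in msupp p); last first.
  rewrite memN_msupp_eq0 // big1_seq // => m' /andP[m'i m'p].
  by rewrite E //; case: eqP => [e|_]; [rewrite -e m'p in pm|rewrite mulr0].
rewrite big_mkcond (bigD1_seq _ pm) ?msupp_uniq //= {1}mnmDE mnm1E eqxx addn1 /=.
rewrite E ?mnmDE ?mnm1E ?eqxx ?addn1 // mulr1 big1 ?addr0 // => m' ne.
by case: ifP => // m'i; rewrite E // (negPf ne) mulr0.
Qed.

Lemma mcoeffXM i (p : R) m : ('X_i * p)@_(m + U_(i)) = p@_m.
Proof. by rewrite mulrC addmC mcoeffMX. Qed.

Lemma msuppXM i (p : R) m :
  (m \in msupp ('X_i * p)) = (0 < m i)%N && ((m - U_(i))%MM \in msupp p).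
Proof.
rewrite mulrC (perm_mem (msuppMX _ _)); apply/mapP/andP.
  move=> [m' m'p ->]; rewrite mnmDE mnm1E eqxx add1n; split=> //.
  by rewrite addmC addmK.
move=> [mi mp]; exists (m - U_(i))%MM => //.
by rewrite addmC submK // lep1mP -lt0n.
Qed.

(* [mideal U p] : all monomials of [p] lie in [U]; for [U] stable under
   multiplication these are the elements of the monomial ideal spanned by [U]. *)
Definition mideal (U : pred 'X_{1..n}) : R^o -> Prop :=
  fun p => forall m, m \in msupp (p : R) -> U m.

Definition upset (U : pred 'X_{1..n}) := forall m m', U m -> U (m + m')%MM.

Definition colon (U : pred 'X_{1..n}) i : pred 'X_{1..n} := fun m => U (m + U_(i))%MM.
Definition addvar (U : pred 'X_{1..n}) i : pred 'X_{1..n} :=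
  fun m => U m || (0 < m i)%N.

Lemma upset_colon U i : upset U -> upset (colon U i).
Proof. by move=> upU m m'; rewrite /colon -addmA [(m' + _)%MM]addmC addmA;
  apply: upU. Qed.

Lemma upset_addvar U i : upset U -> upset (addvar U i).
Proof.
move=> upU m m' /orP[Um|mi]; apply/orP; [left; exact: upU|right].
by rewrite mnmDE addn_gt0 mi.
Qed.

Lemma submod_mideal U : upset U -> submod (mideal U).
Proof.
move=> upU; split=> [m|p q Up Uq m /msuppB_le|a p Up m /msuppM_le].
- by rewrite -[0]/(0 : R) msupp0.
- by rewrite mem_cat => /orP[/Up|/Uq].
- case/allpairsP=> -[m1 m2] /= [m1a m2p ->].
  by rewrite addmC; apply/upU/Up.
Qed.

Lemma mideal_colon U i (p : R) : mideal U ('X_i * p) <-> mideal (colon U i) p.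
Proof.
split=> Up m.
  by rewrite mcoeff_msupp -(mcoeffXM i) -mcoeff_msupp => /Up.
rewrite msuppXM => /andP[mi /Up]; rewrite /colon submK //.
by rewrite lep1mP -lt0n.
Qed.

(** * Koszul homology of monomial ideals *)

Section Graded.
Variables (D : zmodType) (wt : 'I_n -> D).

Definition wdeg m : D := \sum_i wt i *+ m i.

Lemma wdegD m m' : wdeg (m + m') = wdeg m + wdeg m'.
Proof. by rewrite -big_split; apply: eq_bigr => i _; rewrite mnmDE mulrnDr. Qed.

Lemma wdegU i : wdeg U_(i) = wt i.
Proof.
rewrite /wdeg (bigD1 i) //= mnm1E eqxx big1 ?addr0 // => j ne.
by rewrite mnm1E eq_sym (negPf ne).
Qed.

Definition wgr (d : D) : R^o -> Prop :=
  fun p => forall m, m \in msupp (p : R) -> wdeg m = d.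

Definition mvar i : R := 'X_i.

Lemma wgr_graded : graded mvar wt wgr.
Proof.
split=> [d m|d p q gp gq m /msuppB_le|d i p gp m].
- by rewrite -[0]/(0 : R) msupp0.
- by rewrite mem_cat => /orP[/gp|/gq].
- rewrite -[mvar i *: p]/('X_i * (p : R)) msuppXM => /andP[mi /gp <-].
  by rewrite -wdegU -wdegD submK // lep1mP -lt0n.
Qed.

Lemma wgr_mdivX d i p : wgr d p -> wgr (d - wt i) (mdivX i p).
Proof.
move=> gp m; rewrite mcoeff_msupp mcoeff_mdivX -mcoeff_msupp => /gp <-.
by rewrite wdegD wdegU addrK.
Qed.

Lemma wgr_mpick d P p : wgr d p -> wgr d (mpick P p).
Proof.
move=> gp m; rewrite mcoeff_msupp mcoeff_mpick; case: ifP; rewrite ?eqxx // => _.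
by rewrite -mcoeff_msupp; apply: gp.
Qed.

(** The terms of [u] without [x_i] must lie in [U]; the others are divisible by [x_i]. *)
Lemma addvar_split U i d (u : R^o) : wgr d u -> mideal (addvar U i) u ->
  exists a b : R^o, [/\ wgr d a, mideal U a, wgr (d - wt i) b, True & u = a + mvar i *: b].
Proof.
move=> gu Uu; exists (mpick (fun m => m i == 0%N) u), (mdivX i u); split=> //.
- exact: wgr_mpick.
- move=> m; rewrite mcoeff_msupp mcoeff_mpick; case: ifP; rewrite ?eqxx // => mi.
  by rewrite -mcoeff_msupp => /Uu; rewrite /addvar (eqP mi) ltnn orbF.
- exact: wgr_mdivX.
rewrite -[mvar i *: _]/('X_i * mdivX i u).
apply/mpolyP => m; rewrite mcoeffD mcoeff_mpick.
have [mi|mi] := posnP (m i).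
  by rewrite (@memN_msupp_eq0 _ _ ('X_i * _)) ?addr0 // msuppXM mi.
have <- : (m - U_(i) + U_(i) = m)%MM by rewrite submK // lep1mP -lt0n.
by rewrite mcoeffXM mcoeff_mdivX add0r.
Qed.

Local Notation kosR s := (kos (R^o : lmodType R) s).
Local Notation kvan U s p d := (kvanish mvar wt wgr (mideal U) s p d).
Local Notation kd := (kdiff mvar).

Lemma kall_colon U i s (z : kosR s) :
  kall (mideal U) (mvar i *: z) <-> kall (mideal (colon U i)) z.
Proof.
by elim: s z => [|j s IH] z /=; [apply: mideal_colon|rewrite !IH].
Qed.

Lemma kall_addvar_split U i s p d (z : kosR s) :
  kh wt wgr p d z -> kall (mideal (addvar U i)) z -> exists a b,
    [/\ kh wt wgr p d a, kall (mideal U) a, kh wt wgr p (d - wt i) b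
      & z = a + mvar i *: b].
Proof.
move=> hz /(ksplit _ _ wgr_graded (@addvar_split U i) hz)[] //.
  by move=> m; rewrite -[0]/(0 : R) msupp0.
by move=> a [b [? ? ? _ ?]]; exists a, b.
Qed.

Lemma kall_sub U U' s (z : kosR s) : {subset U <= U'} ->
  kall (mideal U) z -> kall (mideal U') z.
Proof. by move=> sU; apply: kall_imp => u Uu m /Uu; apply: sU. Qed.

Lemma kvanish_eq U U' s p d : U =1 U' -> kvan U s p d -> kvan U' s p d.
Proof. by move=> /funext->. Qed.

(** * Long exact sequences for a variable and for a sum of two ideals *)

Section LES.
Variables (U : pred 'X_{1..n}) (i : 'I_n) (s : seq 'I_n).
Hypothesis upU : upset U.
Let subU := kall_submod s (submod_mideal upU).
Let sUv : {subset U <= addvar U i}.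
Proof. by move=> m Um; rewrite unfold_in /addvar [U m]Um. Qed.
Let Uv_add (u : kosR s) b : kall (mideal U) u -> kall (mideal (addvar U i)) (u + mvar i *: b).
Proof.
move=> Uu; apply: (submod_add (kall_submod s (submod_mideal (@upset_addvar _ i upU)))).
  exact: kall_sub Uu.
apply/kall_colon; elim: s b => [|j s' IH] b /=; last by [].
by move=> m _; rewrite /colon /addvar mnmDE mnm1E eqxx addn1 orbT.
Qed.

(** This lemma, [les_sub] and [les_quo] are the three exactness statements for [0 -> R/(U : x_i) ->
    R/U -> R/(U + x_i) -> 0], the first map being multiplication by [x_i] and so shifting degrees by
    [wt i]. *)
Lemma les_mid p d :
  kvan (colon U i) s p (d - wt i) -> kvan (addvar U i) s p d -> kvan U s p d.
Proof.
move=> V1 V2 z hz Uz; have [w hw] := V2 _ hz (kall_sub sUv Uz).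
move/kall_addvar_split=> /(_ p d)[|a [b [ha Ua hb e]]].
  apply: khB => //; [exact: wgr_graded|exact: (kh_diff wgr_graded)].
have [|c hc Uc] := V1 _ hb.
  apply/kall_colon; rewrite -linearZ /=.
  have -> : mvar i *: b = z - kd w - a by rewrite e addrC addKr.
  rewrite !linearB /= kdiffK subr0; have [_ UB _] := subU; apply: UB => //.
  exact/kall_diff/Ua/submod_mideal.
exists (w + mvar i *: c).
  by apply: khD hw _; [exact: wgr_graded|exact: (khX' wgr_graded)].
rewrite linearD linearZ /= opprD addrA e -addrA -scalerBr.
by apply: (submod_add subU) => //; apply/kall_colon.
Qed.

Lemma les_sub p d :
  kvan U s p d -> kvan (addvar U i) s p.+1 d -> kvan (colon U i) s p (d - wt i).
Proof.
move=> V1 V2 b hb Ub.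
have [||c hc Uc] := V1 (mvar i *: b).
- exact: (khX' wgr_graded).
- by rewrite linearZ; apply/kall_colon.
have [|e he] := V2 _ hc.
  have -> : kd c = - (mvar i *: b - kd c) + mvar i *: b by rewrite opprB subrK.
  exact/Uv_add/(submod_opp subU).
move/kall_addvar_split=> /(_ p.+1 d)[|a [f [ha Ua hf ea]]].
  apply: khB => //; [exact: wgr_graded|exact: (kh_diff wgr_graded)].
exists f => //; apply/kall_colon; rewrite scalerBr.
have -> : mvar i *: kd f = kd c - kd a.
  have := congr1 (fun v : kosR s => kd v) ea; rewrite linearB /= kdiffK subr0 => ->.
  by rewrite linearD linearZ /= addrC addKr.
rewrite opprB addrA addrAC; apply: (submod_add subU) => //.
exact/kall_diff/Ua/submod_mideal.
Qed.

Lemma les_quo p d :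
  kvan U s p.+1 d -> kvan (colon U i) s p (d - wt i) -> kvan (addvar U i) s p.+1 d.
Proof.
move=> V1 V2 z hz Uz.
have [u [f [hu Uu hf e]]] := kall_addvar_split (kh_diff wgr_graded hz) Uz.
have dE : mvar i *: kd f = - kd u.
  have := congr1 (fun v : kosR s => kd v) e;
    rewrite kdiffK linearD linearZ /= => /esym/eqP.
  by rewrite addrC addr_eq0 => /eqP.
have [|g hg Ug] := V2 _ hf.
  apply/kall_colon; rewrite dE; apply: (submod_opp subU).
  exact/kall_diff/Uu/submod_mideal.
have [||w hw Uw] := V1 (z - mvar i *: g).
- by apply: khB => //; [exact: wgr_graded|exact: (khX' wgr_graded)].
- rewrite linearB linearZ /= e -addrA -scalerBr.
  by apply: (submod_add subU) => //; apply/kall_colon.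
exists w => //; have -> : z - kd w = (z - mvar i *: g - kd w) + mvar i *: g.
  by rewrite addrAC subrK.
exact: Uv_add.
Qed.

Lemma les_quo0 d : kvan U s 0 d -> kvan (addvar U i) s 0 d.
Proof.
move=> V z hz _; have [|w hw Uw] := V _ hz.
  by rewrite (kdiff_kh0 mvar hz); case: subU.
by exists w => //; apply: kall_sub Uw.
Qed.

End LES.

(** Mayer-Vietoris: exactness at the last term for [0 -> R/(U cap U') -> R/U + R/U' -> R/(U + U') ->
    0]. *)
Lemma les_union U U' s p d : upset U -> upset U' ->
  kvan (predI U U') s p d -> kvan U s p.+1 d -> kvan U' s p.+1 d ->
  kvan (predU U U') s p.+1 d.
Proof.
move=> upU upU' V V1 V2 z hz Uz.
have upI : upset (predI U U').
  by move=> m m' /andP[Um Um']; apply/andP; split; [apply: upU|apply: upU'].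
have upV : upset (predU U U').
  by move=> m m' /orP[Um|Um']; apply/orP; [left; apply: upU|right; apply: upU'].
have sI := kall_submod s (submod_mideal upI).
have sU := kall_submod s (submod_mideal upU).
have sU' := kall_submod s (submod_mideal upU').
have sV := kall_submod s (submod_mideal upV).
have sub1 (v : kosR s) : kall (mideal (predI U U')) v -> kall (mideal U) v.
  by apply: kall_sub => m /andP[].
have sub2 (v : kosR s) : kall (mideal (predI U U')) v -> kall (mideal U') v.
  by apply: kall_sub => m /andP[].
have sub3 (v : kosR s) : kall (mideal U) v -> kall (mideal (predU U U')) v.
  by apply: kall_sub => m Um; apply/orP; left.
have sub4 (v : kosR s) : kall (mideal U') v -> kall (mideal (predU U U')) v.
  by apply: kall_sub => m Um; apply/orP; right.
have [a [b [ha Ua hb Ub e]]] : exists a b : kosR s,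
    [/\ kh wt wgr p d a, kall (mideal U) a, kh wt wgr p (d - 0) b, kall (mideal U') b
      & kd z = a + 1 *: b].
  apply: ksplit Uz; [| |exact: wgr_graded| |exact: (kh_diff wgr_graded)].
  - by move=> m; rewrite -[0]/(0 : R) msupp0.
  - by move=> m; rewrite -[0]/(0 : R) msupp0.
  (* Monomial by monomial: those in [U] go to the first summand, all others must lie in [U']. *)
  move=> d' u gu Uu; exists (mpick U u), (mpick (fun m => ~~ U m) u); rewrite subr0.
  split; try exact: wgr_mpick.
  - move=> m; rewrite mcoeff_msupp mcoeff_mpick; case: ifP; rewrite ?eqxx //.
  - move=> m; rewrite mcoeff_msupp mcoeff_mpick; case: ifP; rewrite ?eqxx // => Um.
    by rewrite -mcoeff_msupp => /Uu /orP[mU|//]; rewrite mU in Um.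
  rewrite scale1r; apply/mpolyP => m; rewrite mcoeffD !mcoeff_mpick.
  by case: (U m); rewrite ?addr0 ?add0r.
rewrite subr0 scale1r in hb e.
have dE : kd a = - kd b.
  by apply/eqP; rewrite -addr_eq0 -linearD -e /= kdiffK.
(* The common value of [kd a] and [- kd b] lies in both ideals, so [a] is a cycle modulo the
   intersection. *)
have [|c hc Uc] := V _ ha.
  apply: (kall_imp (N := fun u => mideal U u /\ mideal U' u)).
    by move=> u [Uu Uu'] m um; apply/andP; split; [apply: Uu|apply: Uu'].
  apply: kall_and; first exact/kall_diff/Ua/submod_mideal.
  by rewrite dE; apply/(submod_opp sU')/kall_diff/Ub/submod_mideal.
have hc' := kh_diff wgr_graded hc.
have [|w1 hw1 Uw1] := V1 c hc.
  have -> : kd c = a - (a - kd c) by rewrite opprB addrC subrK.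
  by have [_ UB _] := sU; apply: UB => //; apply: sub1.
have zc : kd (z - c) = b + (a - kd c) by rewrite linearB /= e addrAC addrC.
have [||w2 hw2 Uw2] := V2 (z - c).
- exact: (khB wgr_graded).
- by rewrite zc; apply: (submod_add sU') => //; apply: sub2.
exists (w1 + w2); first exact: (khD wgr_graded).
have -> : z - kd (w1 + w2) = (c - kd w1) + (z - c - kd w2).
  by rewrite linearD opprD [RHS]addrACA [c + _]addrC subrK.
by apply: (submod_add sV); [apply: sub3|apply: sub4].
Qed.

Lemma kall_mideal_diff U s (z : kosR s) :
  upset U -> {in s, forall j, U U_(j)%MM} -> kall (mideal U) (kd z).
Proof.
move=> upU; have subU := submod_mideal upU.
elim: s z => [|j s IH] z Us /=; first by case: subU.
have Us' : {in s, forall j, U U_(j)%MM} by move=> i si; apply: Us;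
  rewrite in_cons si orbT.
split; last exact/(submod_opp (kall_submod s subU))/IH.
apply: (submod_add (kall_submod s subU)); first exact: IH.
apply/kall_colon; elim: s {IH Us'} z Us => [|i s IH] z Us /=.
  by move=> m _; rewrite /colon addmC; apply/upU/Us/mem_head.
have Us' : {in j :: s, forall j, U U_(j)%MM}.
  by move=> l; rewrite in_cons => /orP[/eqP->|ls]; apply: Us;
    rewrite !in_cons ?eqxx ?ls ?orbT.
(* The claim only concerns the second component of the pair; the first is filled with a value of the
   right type. *)
by split; [apply: (IH (z.2.1, z.2.1))|apply: (IH (z.2.2, z.2.2))].
Qed.

Definition mvars s : pred 'X_{1..n} := fun m => has (fun j => 0 < m j)%N s.

Lemma upset_mvars s : upset (mvars s).
Proof.
move=> m m' /hasP[j sj mj]; apply/hasP; exists j => //.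
by rewrite mnmDE addn_gt0 mj.
Qed.

Lemma mvars_in s j : j \in s -> mvars s U_(j)%MM.
Proof. by move=> sj; apply/hasP; exists j; rewrite // mnm1E eqxx. Qed.

Lemma kdiff_mvars s (z : kosR s) : kall (mideal (mvars s)) (kd z).
Proof. by apply: kall_mideal_diff; [apply: upset_mvars|move=> j; apply: mvars_in]. Qed.

Lemma kos_boundary0 s d (z : kosR s) :
  kh wt wgr 0 d z -> kall (mideal (mvars s)) z ->
  exists2 w, kh wt wgr 1 d w & z = kd w.
Proof.
elim: s z => [|i s IH] z /=.
  move=> _ z0; exists 0 => //; apply/mpolyP => m; rewrite mcoeff0.
  by apply: memN_msupp_eq0; apply/negP => /z0.
case: z => a b /= [ha ->] [Ua _].
have [|a1 [c [ha1 Ua1 hc ->]]] := @kall_addvar_split (mvars s) i _ _ _ _ ha.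
  by apply: kall_sub Ua => m; rewrite !unfold_in /addvar /= orbC.
have [w hw ->] := IH _ ha1 Ua1.
by exists (w, c) => //; congr (_, _); rewrite (kdiff_kh0 mvar hc) oppr0.
Qed.

(** Distinct variables form a regular sequence. This is used when the second component [b] has
    degree 0: [x_i b] lies in the ideal of [s], and since [i] is not in [s] the factor [x_i]
    cancels. *)
Lemma kos_acyclic s p d : uniq s -> kvanish mvar wt wgr (@null _ R^o) s p.+1 d.
Proof.
move=> us; apply/kvanish_nullP.
elim: s p d us => [|i s IH] p d /=; first by move=> _ z -> _; exists 0.
move=> /andP[si us] [a b] /= [ha hb] [e /eqP].
rewrite oppr_eq0 => /eqP db.
have [c hc ec] : exists2 c, kh wt wgr p.+1 (d - wt i) c & b = kd c.
  case: p ha hb => [|p] ha hb; last exact: IH.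
  apply: kos_boundary0 => //.
  have : kall (mideal (mvars s)) (mvar i *: b).
    have -> : mvar i *: b = - kd a by apply/eqP; rewrite -addr_eq0 addrC; apply/eqP.
    apply: (submod_opp (kall_submod s (submod_mideal (@upset_mvars s)))).
    exact: kdiff_mvars.
  move/kall_colon; apply: kall_sub => m /hasP[j sj]; rewrite mnmDE mnm1E.
  have [e1|_] := eqVneq i j; first by rewrite e1 sj in si.
  by rewrite addn0 => mj; apply/hasP; exists j.
have [||w hw ew] := IH p d us (a + mvar i *: c).
- by apply: khD => //; [exact: wgr_graded|exact: (khX' wgr_graded)].
- by rewrite linearD linearZ /= -ec.
exists (w, - c); first by split=> //; apply: (khN wgr_graded).
by congr (_, _); rewrite /= ?linearN /= ?scalerN -?ew ?addrK ?opprK.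
Qed.

(** A chain of homological degree [p] has [l]-degree at least [t * p]. With [t = 0] and a coordinate
    this excludes degrees with a negative entry; with [t = 1] and the total degree it bounds the
    homological degree. *)
Lemma kh_negative (l : {additive D -> int}) (t : nat) s p d (z : kosR s) :
  (forall i, (t%:Z <= l (wt i))%R) -> (l d < (t * p)%N%:Z)%R ->
  kh wt wgr p d z -> z = 0.
Proof.
move=> lt.
have lm m : (0 <= l (wdeg m))%R.
  rewrite raddf_sum; apply: Num.Theory.sumr_ge0 => i _; rewrite raddfMn.
  by apply: Num.Theory.mulrn_wge0; apply: Order.POrderTheory.le_trans (lt i).
elim: s p d z => [|i s IH] [|p] d z ld //=.
- move=> gz; apply/mpolyP => m; rewrite mcoeff0; apply: memN_msupp_eq0.
  apply/negP => /gz e; have := lm m; rewrite e.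
  by rewrite Order.TotalTheory.leNgt (Order.POrderTheory.lt_le_trans ld) // muln0.
- by case: z => a b /= [/(IH _ _ _ ld)-> ->].
- case: z => a b /= [/(IH _ _ _ ld)-> /IH->] //.
  rewrite raddfB Num.Theory.ltrBlDr; apply: Order.POrderTheory.lt_le_trans ld _.
  by rewrite mulnS addnC PoszD Num.Theory.lerD2l.
Qed.

(** As [c] is not in [s], no Koszul generator carries the degree of [x_c]; the exponent 1 in [d]
    must come from the coefficients. *)
Lemma kh_divide (l : {additive D -> int}) c s p d (z : kosR s) :
  (forall m, l (wdeg m) = m c) -> c \notin s -> l d = 1 ->
  kh wt wgr p d z -> exists2 w, kh wt wgr p (d - wt c) w & z = mvar c *: w.
Proof.
move=> lc; elim: s p d z => [|i s IH] p d z /=.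
  case: p => [|p] _ ld gz; last by exists 0; rewrite // gz scaler0.
  exists (mdivX c z); first exact: wgr_mdivX.
  rewrite -[mvar c *: _]/('X_c * mdivX c z); apply/mpolyP => m.
  have [mc|mc] := posnP (m c); last first.
    have <- : (m - U_(c) + U_(c) = m)%MM by rewrite submK // lep1mP -lt0n.
    by rewrite mcoeffXM mcoeff_mdivX.
  rewrite !memN_msupp_eq0 ?msuppXM ?mc //.
  by apply/negP => /gz e; have := lc m; rewrite e ld mc.
rewrite in_cons negb_or => /andP[ci cs] ld; case: z => a b /= [ha hb].
have [a' ha' ->] := IH _ _ _ cs ld ha.
case: p ha hb ha' => [|p] ha hb ha'.
  by exists (a', 0); rewrite // hb; congr (_, _); rewrite /= scaler0.
have [|b' hb' ->] := IH _ _ _ cs _ hb.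
  rewrite raddfB ld -wdegU lc mnm1E eq_sym (negPf ci) subr0 //.
by exists (a', b') => //; split; rewrite // addrAC.
Qed.

(* A variable that occurs in the degree but not in the ideal splits off: in
   squarefree degrees the corresponding simplicial complex is a cone. *)
Lemma kvanish_cone (l : {additive D -> int}) (U : pred 'X_{1..n}) c s p d :
  upset U -> (forall m, l (wdeg m) = m c) -> colon U c =1 U ->
  uniq s -> c \in s -> l d = 1 -> kvan U s p d.
Proof.
move=> upU lc Uc; have subU := submod_mideal upU.
have subUs (t : seq 'I_n) := kall_submod t subU.
have kallc (t : seq 'I_n) (v : kosR t) : kall (mideal U) (mvar c *: v) -> kall (mideal U) v.
  by move/kall_colon; apply: kall_sub => m Um; rewrite unfold_in -Uc.
elim: s p d => [//|i s IH] p d /= /andP[si us];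
  rewrite in_cons => cs ld [a b] [/= ha hb] [/= Ua Ub].
have [e|ci] := eqVneq c i.
  subst i; clear cs IH.
  have [a' ha' ea] := kh_divide lc si ld ha.
  (* Contraction of the cone: [kd (0, a')] is [(x_c a', - kd a')]. Its first entry is [a], and its
     second agrees with [b] modulo [U] because [x_c] cancels there. *)
  exists (0, a'); first by split=> //=; apply: (kh0 wgr_graded).
  rewrite /= linear0 add0r; split=> /=; first by rewrite -ea subrr; have [] := subUs s.
  rewrite opprK; apply: kallc; rewrite scalerDr addrC -linearZ /= -ea.
  exact: Ua.
rewrite (negPf ci) /= in cs.
have Ub' : kall (mideal U) (kd b) by rewrite -[kd b]opprK;
  apply: (submod_opp (subUs s)).
have [c' hc' Uc'] : exists2 c', kh wt wgr p (d - wt i) c' & kall (mideal U) (b - kd c').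
  case: p ha hb => [_ ->|p ha hb].
    by exists 0; rewrite ?linear0 ?addr0; [apply: (kh0 wgr_graded)|have [] := subUs s].
  apply: IH => //; rewrite raddfB ld -wdegU lc mnm1E eq_sym (negPf ci) subr0 //.
have [||w hw Uw] := IH p d us cs ld (a + mvar i *: c').
- by apply: khD => //; [exact: wgr_graded|exact: (khX' wgr_graded)].
- rewrite linearD linearZ /=.
  have -> : kd a + mvar i *: kd c' = kd a + mvar i *: b + - (mvar i *: (b - kd c')).
    by rewrite scalerBr opprB addrA addrAC addrK addrC.
  apply: (submod_add (subUs s)) => //; apply: (submod_opp (subUs s)).
  by have [_ _ UZ] := subUs s; apply: UZ.
exists (w, - c'); first by split=> //; apply: (khN wgr_graded).
have e1 : a + mvar i *: c' - kd w = a - (kd w + mvar i *: - c').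
  by rewrite scalerN opprB addrA.
have e2 : b - kd c' = b - - kd (- c') by rewrite opprK linearN.
by split; [move: Uw; rewrite e1|move: Uc'; rewrite e2].
Qed.

(** The exterior product of the generators indexed by [W], with coefficient 1. *)
Fixpoint ktop (W : pred 'I_n) s : kosR s :=
  match s return kosR s with
  | [::] => (1 : R)
  | i :: s' => if W i then (0, ktop W s') else (ktop W s', 0)
  end.

(** The boundary of [ktop W s] has coefficients in the ideal of the variables of [W], hence in [U].
    The hypothesis on chains of the next degree leaves only 0 to bound it, and its coefficient 1 is
    outside [U]. *)
Lemma kvanish_top (W : pred 'I_n) (U : pred 'X_{1..n}) s (d : D) :
  upset U -> ~~ U 0%MM -> (forall i, W i -> U U_(i)%MM) ->
  d = \sum_(i <- s | W i) wt i ->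
  (forall w : kosR s, kh wt wgr (count W s).+1 d w -> w = 0) ->
  ~ kvan U s (count W s) d.
Proof.
move=> upU U0 UW dE neg V.
have subU (t : seq 'I_n) := kall_submod t (submod_mideal upU).
have [||w /neg-> ] := V (ktop W s).
- rewrite {}dE {V neg}; elim: s => [|i s IH] /=.
    by rewrite big_nil => m; rewrite msupp1 inE => /eqP->;
      rewrite /wdeg big1 // => i; rewrite mnm0E.
  rewrite big_cons; case: ifP => Wi; split=> //=.
  + exact: (kh0 wgr_graded).
  + by rewrite [wt i + _]addrC addrK.
  + by case: (count _ _) => // p; apply: (kh0 wgr_graded).
- clear dE neg V; elim: s => [|i s IH] /=; first by have [] := submod_mideal upU.
  case: ifP => Wi /=; rewrite ?linear0 ?scaler0 ?addr0 ?oppr0 ?add0r; split=> //.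
  + apply/kall_colon; elim: s {IH} => [|j s IH] /=.
      by move=> m _; rewrite /colon addmC; apply/upU/UW.
    by case: ifP => Wj /=; split=> //;
      have [] := kall_submod s (submod_mideal (@upset_colon U i upU)).
  + exact: (submod_opp (subU s)).
  + by have [] := subU s.
rewrite linear0 subr0; clear w dE neg V; elim: s => [|i s IH] /=.
  by move=> /(_ 0%MM); rewrite msupp1 inE eqxx => /(_ isT); rewrite (negPf U0).
by case: ifP => Wi /= [].
Qed.

Fixpoint klast s (f : R^o) : kosR s :=
  match s return kosR s with [::] => f | i :: s' => (0, klast s' f) end.

(** A chain of top degree is a single coefficient [f], and it is a cycle modulo [U] when every
    [x_i f] lies in [U]: top Koszul homology is the socle. *)
Lemma kvanish_socle (U : pred 'X_{1..n}) s d :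
  upset U -> (forall m, {in s, forall i, U (m + U_(i))%MM} -> U m) ->
  kvan U s (size s) d.
Proof.
move=> upU socU z hz Uz.
have subU (t : seq 'I_n) := kall_submod t (submod_mideal upU).
exists 0; first exact: (kh0 wgr_graded).
rewrite linear0 subr0.
have [f ez] : exists f, z = klast s f.
  elim: s d z hz {Uz socU} => [|i s IH] d z /=; first by exists z.
  case: z => a b /= [ha /IH[f ->]]; exists f.
  by rewrite (kh_big _ ha).
rewrite {}ez {z hz} in Uz *.
have Uf i : i \in s -> mideal (colon U i) f.
  elim: s Uz {socU} => [//|j s IH] /=;
    rewrite linear0 add0r => -[Uj /(submod_opp (subU s))].
  rewrite opprK => Us; rewrite in_cons => /orP[/eqP->|/(IH Us) //].
  by move/kall_colon: Uj; elim: s {IH Us} => [//|l s IH] /= [_ /IH].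
have Um : mideal U f by move=> m fm; apply: socU => i si; apply: Uf.
by elim: s {Uz socU Uf} => [//|i s IH] /=; split=> //; have [] := subU s.
Qed.

End Graded.

(** * Comparison of a grading with a coarser one *)

Section Projection.
Variables (D D' : zmodType) (wt : 'I_n -> D) (wt' : 'I_n -> D') (h : {additive D' -> D}).
Hypothesis hwt : forall i, h (wt' i) = wt i.
Local Notation kosR s := (kos (R^o : lmodType R) s).

Fixpoint kproj s (d : D') : kosR s -> kosR s :=
  match s return kosR s -> kosR s with
  | [::] => fun z => mpick (fun m => wdeg wt' m == d) z
  | i :: s' => fun z => (kproj d z.1, kproj (d - wt' i) z.2)
  end.

Lemma wdeg_hom m : h (wdeg wt' m) = wdeg wt m.
Proof. by rewrite raddf_sum; apply: eq_bigr => i _; rewrite raddfMn hwt. Qed.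

Lemma kproj_add s d (u v : kosR s) : kproj d (u + v) = kproj d u + kproj d v.
Proof.
elim: s d u v => [|i s IH] d u v /=; last by rewrite !IH.
apply/mpolyP => m; rewrite mcoeffD !mcoeff_mpick mcoeffD.
by case: ifP; rewrite ?addr0.
Qed.

Lemma kproj_opp s d (u : kosR s) : kproj d (- u) = - kproj d u.
Proof.
elim: s d u => [|i s IH] d u /=; last by rewrite !IH.
apply/mpolyP => m; rewrite mcoeffN !mcoeff_mpick mcoeffN.
by case: ifP; rewrite ?oppr0.
Qed.

Lemma kproj0 s d : kproj d (0 : kosR s) = 0.
Proof. by rewrite -{1}(subrr (0 : kosR s)) kproj_add kproj_opp subrr. Qed.

Lemma kproj_X s d i (u : kosR s) : kproj d (mvar i *: u) = mvar i *: kproj (d - wt' i) u.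
Proof.
elim: s d u => [|j s IH] d u /=; last first.
  rewrite !IH; congr (_, _); rewrite /= addrAC //.
rewrite -[mvar i *: u]/('X_i * (u : R)) -[RHS]/('X_i * mpick _ _).
apply/mpolyP => m; rewrite mcoeff_mpick.
have [mi|mi] := posnP (m i).
  by rewrite !(@memN_msupp_eq0 _ _ ('X_i * _)) ?if_same // msuppXM mi.
have <- : (m - U_(i) + U_(i) = m)%MM by rewrite submK // lep1mP -lt0n.
by rewrite !mcoeffXM mcoeff_mpick wdegD wdegU -subr_eq opprK.
Qed.

Lemma kproj_diff s d (z : kosR s) : kproj d (kdiff mvar z) = kdiff mvar (kproj d z).
Proof.
elim: s d z => [|i s IH] d z /=.
  by apply/mpolyP => m; rewrite mcoeff_mpick mcoeff0 if_same.
by rewrite kproj_add kproj_opp kproj_X !IH.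
Qed.

Lemma kproj_id s p d (z : kosR s) : kh wt' (wgr wt') p d z -> kproj d z = z.
Proof.
elim: s p d z => [|i s IH] [|p] d z /=.
- move=> gz; apply/mpolyP => m; rewrite mcoeff_mpick; case: eqP => // ne.
  by rewrite memN_msupp_eq0 //; apply/negP => /gz.
- move=> ->; apply/mpolyP => m; rewrite mcoeff_mpick mcoeff0 if_same //.
- by case: z => a b /= [/IH-> ->]; rewrite kproj0.
- by case: z => a b /= [/IH-> /IH->].
Qed.

Lemma kproj_kh s p d (z : kosR s) :
  kh wt (wgr wt) p (h d) z -> kh wt' (wgr wt') p d (kproj d z).
Proof.
elim: s p d z => [|i s IH] [|p] d z /=.
- move=> _ m; rewrite mcoeff_msupp mcoeff_mpick;
  by have [|_] := eqVneq (wdeg wt' m) d; rewrite ?eqxx.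
- by move=> ->; apply: (@kproj0 [::]).
- by move=> [/IH ? ->]; rewrite kproj0.
- by move=> [/IH ? hb]; split=> //; apply: IH; rewrite raddfB hwt.
Qed.

(** A chain found in the coarse degree is cut down to its component of fine degree [d]. This
    projection commutes with the differential and preserves monomial ideals. *)
Lemma kvanish_refine U s p d :
  kvanish mvar wt (wgr wt) (mideal U) s p (h d) ->
  kvanish mvar wt' (wgr wt') (mideal U) s p d.
Proof.
move=> V z hz Uz; have [|w hw Uw] := V z _ Uz.
  elim: s p d z hz {V Uz} => [|i s IH] [|p] d z //=.
  - by move=> gz m /gz <-; rewrite wdeg_hom.
  - by move=> [/IH ? ->].
  - by move=> [/IH ? /IH]; rewrite raddfB hwt.
exists (kproj d w); first exact: kproj_kh.
rewrite -kproj_diff -(kproj_id hz) -kproj_opp -kproj_add.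
move: (z - kdiff mvar w) Uw; clear z w hz hw Uz V.
elim: s d => [|i s IH] d z /=.
  move=> Uz m; rewrite mcoeff_msupp mcoeff_mpick; case: ifP; rewrite ?eqxx // => _.
  by rewrite -mcoeff_msupp; apply: Uz.
by move=> [? ?]; split; apply: IH.
Qed.

End Projection.
End Monomials.

(** * Finite generation *)

Section Noetherian.
Variables (k : fieldType) (n : nat).
Local Notation R := {mpoly k[n]}.

(** Dickson's lemma, for divisibility tested on the coordinates in [s] only. Beyond the bound [B] on
    the new coordinate the list [L0] suffices; below it, each of the finitely many slices has its
    own list. *)
Lemma dickson (s : seq 'I_n) (P : 'X_{1..n} -> Prop) :
  exists L : seq 'X_{1..n}, {in L, forall l, P l} /\
    forall m, P m -> exists2 l, l \in L & {in s, forall j, (l j <= m j)%N}.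
Proof.
elim: s P => [|j s IH] P.
  have [[m Pm]|nP] := pselect (exists m, P m).
    exists [:: m]; split=> [l|m' _]; first by rewrite inE => /eqP->.
    by exists m; rewrite ?inE.
  by exists [::]; split=> // m Pm; case: nP; exists m.
have [L0 [PL0 L0P]] := IH P.
have /choice[L LP] v := IH (fun m => P m /\ m j = v).
pose B := \max_(l <- L0) l j.
exists (L0 ++ flatten [seq L v | v <- iota 0 B]); split=> [l|m Pm].
  rewrite mem_cat => /orP[/PL0 //|/flatten_mapP[v _ lL]].
  by have [/(_ _ lL)[]] := LP v.
have [Bm|mB] := leqP B (m j).
  have [l lL0 lm] := L0P m Pm; exists l; first by rewrite mem_cat lL0.
  move=> i; rewrite in_cons => /orP[/eqP->|/lm //].
  exact: leq_trans (leq_bigmax_seq _ lL0 isT) Bm.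
have [_ /(_ m)[//|l lL lm]] := LP (m j).
exists l => [|i].
  rewrite mem_cat; apply/orP; right; apply/flatten_mapP.
  by exists (m j); rewrite // mem_iota.
rewrite in_cons => /orP[/eqP->|/lm //].
by have [/(_ _ lL)[_ ->]] := LP (m j).
Qed.

Definition fin_gen (M : lmodType R) (Z : M -> Prop) : Prop :=
  exists L : seq M, {in L, forall g, Z g} /\
    forall N : M -> Prop, submod N -> {in L, forall g, N g} -> forall v, Z v -> N v.

(** Hilbert's basis theorem through leading monomials: by Dickson's lemma finitely many of them
    divide all the others, and each division step lowers the leading monomial. *)
Lemma ideal_fin_gen (I : R^o -> Prop) : submod I -> fin_gen I.
Proof.
move=> [I0 IB IZ].
have [L [PL LP]] := dickson (enum 'I_n)
  (fun m => exists f : R^o, [/\ f != 0, I f & mlead (f : R) = m]).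
have /choice[g gP] : forall l, exists g : R^o,
    l \in L -> [/\ g != 0, I g & mlead (g : R) = l].
  move=> l; have [/PL[g gl]|nl] := boolP (l \in L); first by exists g.
  by exists 0.
exists [seq g l | l <- L]; split=> [_ /mapP[l /gP[_ ? _] ->] //|N subN Ng v].
elim/mleadrect: v => v IH Iv.
have [v0|v_neq0] := eqVneq v 0; first by rewrite v0; have [] := subN.
have [|l lL lv] := LP (mlead (v : R)); first by exists v.
have [g_neq0 Ig mg] := gP l lL.
have Ngl : N (g l) by apply: Ng; apply: map_f.
have lmv : (l <= mlead (v : R))%MM.
  by apply/mnm_lepP => i; apply: lv; rewrite mem_enum.
pose a : R := (v@_(mlead (v : R)) / (g l)@_l) *: 'X_[mlead (v : R) - l].
pose w : R^o := v - a *: g l.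
have gl_neq0 : (g l)@_l != 0 by have := g_neq0;
  rewrite -[g l == 0]/((g l : R) == 0) -mleadc_eq0 mg.
have wE : w = v - a * (g l : R) :> R by [].
have av : (a * (g l : R))@_(mlead (v : R)) = v@_(mlead (v : R)).
  have e : ('X_[mlead (v : R) - l] * (g l : R))@_(mlead (v : R)) = (g l)@_l.
    by rewrite mulrC -{1}(submK lmv) mcoeffMX.
  by rewrite -scalerAl mcoeffZ e divfK.
have Na : N (a *: g l) by have [_ _ NZ] := subN; apply: NZ.
have vE : v = w + a *: g l by rewrite subrK.
suff Nw : N w by rewrite vE; exact: (submod_add subN Nw Na).
have [w0|w_neq0] := eqVneq w 0; first by rewrite w0; have [] := subN.
apply: IH; last by apply: IB => //; apply: IZ.
rewrite lt_neqAle; apply/andP; split.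
  apply/eqP => e; move: w_neq0; rewrite -mleadc_eq0 e wE mcoeffB av subrr eqxx //.
rewrite wE; apply: le_trans (mleadB_le _ _) _.
rewrite leUx lexx /=.
apply: le_trans (mleadM_le _ _) _.
rewrite mg -(submK lmv) lemc_add2l.
by apply: le_trans (mleadZ_le _ _) _; rewrite mleadXm.
Qed.

(** Induction on the number [t] of coordinates allowed to be nonzero. The last allowed entries form
    an ideal; once generators of it are lifted, subtracting a combination clears that entry. *)
Lemma row_fin_gen q (Z : 'rV[R]_q -> Prop) : submod Z -> fin_gen Z.
Proof.
move=> subZ; have [Z0 ZB ZZ] := subZ.
suff H t : (t <= q)%N -> fin_gen (fun v => Z v /\ forall a : 'I_q, (t <= a)%N -> v 0 a = 0).
  have [L [LZ LP]] := H q (leqnn q); exists L; split=> [g /LZ[]//|N subN LN v Zv].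
  by apply: LP => //; split=> // a; rewrite leqNgt ltn_ord.
elim: t => [_|t IH tq].
  exists [::]; split=> // N [N0 _ _] _ v [_ v0].
  by have -> : v = 0 by apply/rowP => a; rewrite v0 // mxE.
have [L [LZ LP]] := IH (ltnW tq); pose b := Ordinal tq.
pose Zt (v : 'rV[R]_q) := Z v /\ forall a : 'I_q, (t < a)%N -> v 0 a = 0.
have subZt : submod Zt.
  split; first by split=> // a _; rewrite mxE.
    move=> u v [Zu u0] [Zv v0]; split; first exact: ZB.
    by move=> a ta; rewrite !mxE u0 ?v0 ?subr0.
  move=> c u [Zu u0]; split; first exact: ZZ.
  by move=> a ta; rewrite !mxE u0 ?mulr0.
have [Zt0 ZtB ZtZ] := subZt.
have [|J [JI JP]] := @ideal_fin_gen (fun r => exists2 v, Zt v & v 0 b = r).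
  split; first by exists 0; rewrite // mxE.
    move=> r r' [u Zu <-] [v Zv <-]; exists (u - v); first exact: ZtB.
    by rewrite !mxE.
  by move=> c r [u Zu <-]; exists (c *: u); [apply: ZtZ|rewrite !mxE].
have /choice[w wP] : forall r : R^o, exists v, r \in J -> Zt v /\ v 0 b = r.
  move=> r; have [/JI[v Zv vr]|nr] := boolP (r \in J); first by exists v.
  by exists 0.
exists ([seq w r | r <- J] ++ L); split=> [g|N subN LN v Zv].
  rewrite mem_cat => /orP[/mapP[r /wP[Zw _] -> //]|/LZ[Zg g0]].
  by split=> // a ta; apply/g0/ltnW.
have [N0 NB NZ] := subN.
have [|||u [Nu Zu uv]] := JP (fun r => exists u, [/\ N u, Zt u & u 0 b = r]) _ _ (v 0 b).
- split; first by exists 0; split; rewrite ?mxE.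
    move=> r r' [u [Nu Zu <-]] [u' [Nu' Zu' <-]]; exists (u - u').
    by split; [apply: NB|apply: ZtB|rewrite !mxE].
  move=> c r [u [Nu Zu <-]]; exists (c *: u).
  by split; [apply: NZ|apply: ZtZ|rewrite !mxE].
- move=> r rJ; exists (w r); have [Zw wr] := wP _ rJ; split=> //.
  by apply: LN; rewrite mem_cat map_f.
- by exists v.
have [Zvu vu0] := ZtB _ _ Zv Zu.
have -> : v = u + (v - u) by rewrite addrC subrK.
apply: (submod_add subN) => //; apply: LP => //.
  by move=> g gL; apply: LN; rewrite mem_cat gL orbT.
split=> // a; rewrite leq_eqVlt => /orP[/eqP ta|]; last exact: vu0.
have -> : a = b by apply: val_inj.
by rewrite !mxE uv subrr.
Qed.

End Noetherian.

(** * Minimal graded free resolutions *)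

Section Graded.
Variables (k : fieldType) (n : nat).
Local Notation R := {mpoly k[n]}.

Definition hgr q (dg : 'I_q -> nat) (d : nat) (v : 'rV[R]_q) : Prop :=
  forall a m, m \in msupp (v 0 a) -> (mdeg m + dg a)%N = d.

Definition hcomp q (dg : 'I_q -> nat) (d : nat) (v : 'rV[R]_q) : 'rV[R]_q :=
  \row_a mpick (fun m => mdeg m + dg a == d)%N (v 0 a).

Section Component.
Variables (q : nat) (dg : 'I_q -> nat).
Implicit Types v : 'rV[R]_q.

Lemma hgr_hcomp d v : hgr dg d (hcomp dg d v).
Proof.
move=> a m; rewrite mxE mcoeff_msupp mcoeff_mpick.
by have [|_] := eqVneq (mdeg m + dg a)%N d; rewrite ?eqxx.
Qed.

Lemma hcompB d u v : hcomp dg d (u - v) = hcomp dg d u - hcomp dg d v.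
Proof.
apply/rowP => a; rewrite !mxE; apply/mpolyP => m.
by rewrite mcoeffB !mcoeff_mpick mcoeffB; case: ifP; rewrite ?subr0.
Qed.

Lemma hcomp0 d : hcomp dg d 0 = 0.
Proof. by rewrite -{1}(subrr 0) hcompB subrr. Qed.

Lemma hcomp_sum d (I : Type) (s : seq I) (F : I -> 'rV[R]_q) :
  hcomp dg d (\sum_(i <- s) F i) = \sum_(i <- s) hcomp dg d (F i).
Proof.
elim: s => [|i s IH]; first by rewrite !big_nil hcomp0.
rewrite !big_cons -IH -[\sum_(j <- s) F j in LHS]opprK -[in X in _ - X]sub0r.
by rewrite !hcompB hcomp0 sub0r opprK.
Qed.

Lemma hcomp_id d e v : hgr dg e v -> hcomp dg d v = if e == d then v else 0.
Proof.
move=> hv; apply/rowP => a; rewrite !mxE; apply/mpolyP => m.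
rewrite mcoeff_mpick (fun_if (fun w : 'rV[R]_q => w 0 a)) (fun_if (mcoeff m)) mxE mcoeff0.
have [ma|ma] := boolP (m \in msupp (v 0 a)); first by rewrite (hv _ _ ma).
by rewrite memN_msupp_eq0 ?if_same.
Qed.

Lemma hcomp_decomp v : exists B, v = \sum_(0 <= d < B) hcomp dg d v.
Proof.
exists (\max_a (msize (v 0%R a) + dg a)%N).
apply/rowP => a; rewrite summxE; apply/mpolyP => m; rewrite raddf_sum /=.
under eq_bigr do rewrite mxE mcoeff_mpick.
have [ma|ma] := boolP (m \in msupp (v 0 a)); last first.
  by rewrite memN_msupp_eq0 // big1 // => d _; rewrite if_same.
have mB : (mdeg m + dg a < \max_a (msize (v 0%R a) + dg a))%N.
  by apply: leq_trans (leq_bigmax a); rewrite ltn_add2r msize_mdeg_lt.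
rewrite (bigD1_seq (mdeg m + dg a)%N) ?mem_index_iota ?iota_uniq //= eqxx.
by rewrite big1 ?addr0 // => d; rewrite eq_sym => /negPf->.
Qed.

Lemma hgr_mulmx r (dg' : 'I_r -> nat) (A : 'M[R]_(r, q)) d (y : 'rV[R]_r) :
  (forall b, hgr dg (dg' b) (row b A)) -> hgr dg' d y -> hgr dg d (y *m A).
Proof.
move=> hA hy a m; rewrite mxE => /msupp_sum_le /flattenP[_ /mapP[b _ ->]].
move=> /msuppM_le /allpairsP[[m1 m2] /= [m1y m2A ->]].
have := hA b a m2; rewrite mxE => /(_ m2A) e.
by rewrite mdegD -addnA e; apply: hy.
Qed.

End Component.

Lemma hcomp_mulmx q r (dg : 'I_q -> nat) (dg' : 'I_r -> nat) (A : 'M[R]_(r, q)) d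
    (y : 'rV[R]_r) :
  (forall b, hgr dg (dg' b) (row b A)) ->
  hcomp dg d (y *m A) = hcomp dg' d y *m A.
Proof.
move=> hA; have [B yE] := hcomp_decomp dg' y.
rewrite {2}yE {1}yE mulmx_suml !hcomp_sum mulmx_suml; apply: eq_bigr => e _.
rewrite (hcomp_id d (hgr_mulmx hA (@hgr_hcomp _ dg' e y))) (hcomp_id d (@hgr_hcomp _ dg' e y)).
by case: ifP => // _; rewrite mul0mx.
Qed.

Definition spans q (Z : 'rV[R]_q -> Prop) r (A : 'M[R]_(r, q)) : Prop :=
  (forall b, Z (row b A)) /\ forall v, Z v -> exists y, v = y *m A.

Definition hspanned q (dg : 'I_q -> nat) (Z : 'rV[R]_q -> Prop) r : Prop :=
  exists (A : 'M[R]_(r, q)) (dg' : 'I_r -> nat),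
    spans Z A /\ forall b, hgr dg (dg' b) (row b A).

Section Submodule.
Variables (q : nat) (dg : 'I_q -> nat) (Z : 'rV[R]_q -> Prop).
Hypotheses (subZ : submod Z) (homZ : forall d v, Z v -> Z (hcomp dg d v)).

(** The homogeneous components of a finite generating set stay in [Z] by [homZ] and still generate
    it. *)
Lemma hspanned_exists : exists r, hspanned dg Z r.
Proof.
have [L [LZ LP]] := row_fin_gen subZ.
have /choice[B BP] := hcomp_decomp dg.
pose S := [seq (d, hcomp dg d v) | v <- L, d <- iota 0 (B v)].
pose A : 'M[R]_(size S, q) := \matrix_b (nth (0%N, 0) S b).2.
exists (size S), A, (fun b => (nth (0%N, 0) S b).1).
have SP (b : 'I_(size S)) : exists d v,
    [/\ v \in L, (d < B v)%N & nth (0%N, 0) S b = (d, hcomp dg d v)].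
  have /allpairsPdep[v [d [vL dB ->]]] := mem_nth (0%N, 0) (ltn_ord b).
  by exists d, v; split=> //; move: dB; rewrite mem_iota.
split; last by move=> b; rewrite rowK; have [d [v [_ _ ->]]] := SP b; apply: hgr_hcomp.
split=> [b|]; first by rewrite rowK; have [d [v [vL _ ->]]] := SP b; apply/homZ/LZ.
apply: LP.
  split; first by exists 0; rewrite mul0mx.
    by move=> _ _ [y ->] [y' ->]; exists (y - y'); rewrite mulmxBl.
  by move=> c _ [y ->]; exists (c *: y); rewrite -scalemxAl.
move=> v vL; rewrite [v]BP.
have H d : d \in iota 0 (B v) -> exists y, hcomp dg d v = y *m A.
  move=> dB; have dS : (d, hcomp dg d v) \in S by apply/allpairsPdep; exists v, d.
  have iS : (index (d, hcomp dg d v) S < size S)%N by rewrite index_mem.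
  by exists (delta_mx 0 (Ordinal iS)); rewrite -rowE rowK /= nth_index.
rewrite /index_iota subn0; elim: (iota 0 (B v)) H => [|d s IH] H.
  by exists 0; rewrite big_nil mul0mx.
have [|y ey] := IH; first by move=> e es; apply: H; rewrite in_cons es orbT.
have [y' ey'] := H d (mem_head _ _).
by exists (y' + y); rewrite big_cons ey ey' mulmxDl.
Qed.

(* A generating set of minimal size has no relation with a unit coefficient:
   such a relation would make one generator redundant. *)
Lemma hspanned_minimal : exists r (A : 'M[R]_(r, q)) (dg' : 'I_r -> nat),
  [/\ spans Z A, forall b, hgr dg (dg' b) (row b A)
    & forall y : 'rV_r, y *m A = 0 -> forall b, (y 0 b)@_0%MM = 0].
Proof.
have ex : exists r, `[< hspanned dg Z r >].
  by have [r hr] := hspanned_exists; exists r; apply/asboolP.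
case: (ex_minnP ex) => r /asboolP[A [dg' [[AZ Aspan] hA]]] rmin.
exists r, A, dg'; split=> // y yA b; apply/eqP; apply: contraT => yb.
have {rmin} [r' er rmin] : exists2 r', r = r'.+1 & forall t, hspanned dg Z t -> (r' < t)%N.
  case: r b {y yA yb AZ Aspan hA A dg'} rmin => [[]//|r'] _ rmin; exists r' => // t ht.
  by apply: rmin; apply/asboolP.
subst r; suff /rmin : hspanned dg Z r' by rewrite ltnn.
(* In the component of degree [dg' b] the coefficient of generator [b] is exactly the constant [c],
   which is invertible. *)
pose c := (y 0 b)@_0%MM; pose y' := hcomp dg' (dg' b) y.
have y'b : y' 0 b = c%:MP.
  rewrite mxE; apply/mpolyP => m; rewrite mcoeff_mpick mcoeffC.
  rewrite -{2}[dg' b]add0n eqn_add2r mdeg_eq0 eq_sym.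
  by have [<-|_] := eqVneq 0%MM m; rewrite ?mulr1 ?mulr0.
have y'A : y' *m A = 0 by rewrite -(hcomp_mulmx _ _ hA) yA hcomp0.
have rowb : row b A = \sum_(j < r') (- c^-1%:MP * y' 0 (lift b j)) *: row (lift b j) A.
  have : y' *m A = y' 0 b *: row b A + \sum_(j < r') y' 0 (lift b j) *: row (lift b j) A.
    rewrite mulmx_sum_row (bigD1_ord b) //=.
  rewrite y'A y'b => /esym/eqP; rewrite addr_eq0 => /eqP e.
  have -> : row b A = c^-1%:MP *: (c%:MP *: row b A).
    by rewrite scalerA -mpolyCM mulVf // mpolyC1 scale1r.
  rewrite e scalerN scaler_sumr -sumrN; apply: eq_bigr => j _.
  by rewrite scalerA mulNr scaleNr.
exists (row' b A), (dg' \o lift b).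
have rowj j : row j (row' b A) = row (lift b j) A by apply/rowP => a; rewrite !mxE.
split; last by move=> j; rewrite rowj; apply: hA.
split=> [j|v /Aspan[z ->]]; first by rewrite rowj.
exists (\row_j (z 0 (lift b j) + z 0 b * (- c^-1%:MP * y' 0 (lift b j)))).
rewrite [RHS]mulmx_sum_row mulmx_sum_row (bigD1_ord b) //= {1}rowb scaler_sumr -big_split.
apply: eq_bigr => j _; rewrite /= rowj mxE scalerDl scalerA addrC.
by [].
Qed.

End Submodule.

(** A free module of the resolution under construction, with the kernel that the next differential
    must cover. The field [st_min] on this kernel becomes minimality of that differential. *)
Record stage := Stage {
  st_rank : nat;
  st_deg : 'I_st_rank -> nat;
  st_rel : 'rV[R]_st_rank -> Prop;
  st_sub : submod st_rel;
  st_hom : forall d v, st_rel v -> st_rel (hcomp st_deg d v);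
  st_min : forall v, st_rel v -> forall a, (v 0 a)@_0%MM = 0 }.

Lemma stage_step (S : stage) :
  exists SA : {S' : stage & 'M[R]_(st_rank S', st_rank S)},
    [/\ forall b, hgr (@st_deg S) (st_deg b) (row b (projT2 SA)),
        forall v, st_rel v <-> exists y, v = y *m projT2 SA
      & forall y, st_rel (s := projT1 SA) y <-> y *m projT2 SA = 0].
Proof.
have [r [A [dg [[AZ Aspan] hA Amin]]]] := hspanned_minimal (st_sub S) (@st_hom S).
have rsub : submod (fun y : 'rV[R]_r => y *m A = 0).
  split; first by rewrite mul0mx.
    by move=> u v u0 v0; rewrite mulmxBl u0 v0 subr0.
  by move=> c u u0; rewrite -scalemxAl u0 scaler0.
have rhom d y : y *m A = 0 -> hcomp dg d y *m A = 0.
  by move=> yA; rewrite -(hcomp_mulmx _ _ hA) yA hcomp0.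
exists (existT _ (Stage rsub rhom Amin) A); split=> //= v; split; first exact: Aspan.
move=> [y ->]; rewrite mulmx_sum_row; have subS := st_sub S; have [S0 SB SZ] := subS.
elim: (index_enum _) => [|b s IH]; first by rewrite big_nil.
by rewrite big_cons; apply: (submod_add subS) => //; apply: SZ.
Qed.

Definition stage_next (S : stage) := projT1 (sval (cid (stage_step S))).
Definition stage_mat (S : stage) : 'M[R]_(st_rank (stage_next S), st_rank S) :=
  projT2 (sval (cid (stage_step S))).

Lemma stage_matP S :
  [/\ forall b, hgr (@st_deg S) (st_deg b) (row b (stage_mat S)),
      forall v, st_rel v <-> exists y, v = y *m stage_mat S
    & forall y, st_rel (s := stage_next S) y <-> y *m stage_mat S = 0].
Proof. exact: svalP (cid (stage_step S)). Qed.

Lemma min_resolution_exists (M : lmodType R) (gr : nat -> M -> Prop)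
    (aug : {linear 'rV[R]_1 -> M}) :
  gr 0%N (aug (delta_mx 0 0)) -> Defs.surjective aug ->
  (forall d v, aug v = 0 -> aug (hcomp (fun=> 0%N) d v) = 0) ->
  (forall v, aug v = 0 -> (v 0 0)@_0%MM = 0) ->
  exists F : min_graded_free_resolution gr, True.
Proof.
move=> gr_aug surj hom min.
have sub0 : submod (fun v : 'rV[R]_1 => aug v = 0).
  split; first by rewrite linear0.
    by move=> u v u0 v0; rewrite linearB /= u0 v0 subr0.
  by move=> c u u0; rewrite linearZ /= u0 scaler0.
have min0 v : aug v = 0 -> forall a, (v 0 a)@_0%MM = 0.
  by move=> v0 a; rewrite ord1 min.
pose S i := iter i stage_next (Stage sub0 hom min0).
pose dif i : 'M[R]_(st_rank (S i.+1), st_rank (S i)) := stage_mat (S i).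
have dmin i a b : (dif i a b)@_0%MM = 0.
  have : st_rel (s := S i) (row a (dif i)).
    have [_ P _] := stage_matP (S i); apply/P; exists (delta_mx 0 a).
    by rewrite -rowE.
  by move/st_min => /(_ b); rewrite mxE.
unshelve eexists (@MinGradedFreeResolution k n M gr (fun i => st_rank (S i))
  (fun i => @st_deg (S i)) dif aug _ _ surj _ _ dmin) => //.
- move=> i a b; have [P _ _] := stage_matP (S i).
  have [->|ne] := eqVneq (dif i a b) 0; first by left.
  right; exists (st_deg (s := S i.+1) a - st_deg (s := S i) b)%N.
    have := P a b _; rewrite mxE => /(_ _ (mlead_supp ne)) <-.
    by rewrite addnK addnC.
  apply/dhomogP => m; have := P a b m; rewrite mxE => H /H <-.
  by rewrite addnK.
- by move=> a; rewrite ord1.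
- by move=> x; have [_ P _] := stage_matP (S 0%N); apply: P.
- move=> i x; have [_ _ P] := stage_matP (S i); have [_ P' _] := stage_matP (S i.+1).
  by rewrite -P'; apply: iff_sym; apply: P.
Qed.

End Graded.

(** * Resolutions and Koszul homology *)

Section AugmentedSequence.
Variables (R : comNzRingType) (M : lmodType R) (P : nat -> lmodType R).
Variables (dif : forall p, {linear P p.+1 -> P p}) (aug : {linear P 0%N -> M}).

(** The resolved module sits at index 0 and the [p]-th term at [p.+1], as [resolution_lift] and
    [resolution_descend] expect. *)
Definition aug_mod (p : nat) : lmodType R := if p is p'.+1 then P p' else M.

Definition aug_map (p : nat) : {linear aug_mod p.+1 -> aug_mod p} :=
  match p return {linear aug_mod p.+1 -> aug_mod p} with
  | 0%N => aug
  | p'.+1 => dif p'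
  end.

End AugmentedSequence.

(** * Free modules on arbitrary sets and acyclicity of projective modules *)

Section FreeModule.
Import freeg.
Variables (R : comNzRingType) (K : choiceType) (M : lmodType R) (f : K -> M).

Fact coeff_linear x : linear_for *%R (@coeff R K x).
Proof. by move=> c D E; rewrite coeffD coeffZ. Qed.

Definition free_coeff x : {linear {freeg K / R} -> R^o} :=
  HB.pack (coeff x : {freeg K / R} -> R^o)
    (GRing.isLinear.Build R {freeg K / R} R^o _ (coeff x) (@coeff_linear x)).

Fact freegU_linear x : linear (fun c : R^o => << (c : R) *g x >> : {freeg K / R}).
Proof.
move=> c a b; rewrite -freegUD; congr (_ + _).
by apply/eqP/freeg_eqP => y; rewrite coeffZ !coeffU mulrA.
Qed.

Definition free_inj x : {linear R^o -> {freeg K / R}} :=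
  HB.pack (fun c : R^o => << (c : R) *g x >> : {freeg K / R})
    (GRing.isLinear.Build R R^o {freeg K / R} _ _ (@freegU_linear x)).

Fact fglift_linear : linear (fglift f : {freeg K / R} -> M).
Proof.
pose g : {additive {freeg K / R} -> M} :=
  HB.pack (fglift f : {freeg K / R} -> M)
    (GRing.isAdditive.Build _ _ _ (@lift_is_additive R K M f)).
move=> c D E; rewrite -[LHS]/(g _) raddfD; congr (_ + _).
rewrite -[c *: D]/(fgscale c D) raddf_sum -[in RHS](freeg_sumE D).
rewrite -[fglift f _ in RHS]/(g _) raddf_sum scaler_sumr.
apply: eq_bigr => x _.
by rewrite /= !liftU scalerA.
Qed.

Definition free_lift : {linear {freeg K / R} -> M} :=
  HB.pack (fglift f : {freeg K / R} -> M)
    (GRing.isLinear.Build R {freeg K / R} M _ _ fglift_linear).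

Lemma free_liftU x : free_lift << x >> = f x.
Proof. by rewrite /= liftU scale1r. Qed.

Lemma free_decomp (D : {freeg K / R}) :
  D = \sum_(x <- dom D) free_inj x (free_coeff x D).
Proof. by rewrite {1}[D](esym (freeg_sumE D)). Qed.

Lemma free_support (I : Type) (s : seq I) (z : kos ({freeg K / R} : lmodType R) s) :
  exists L : seq K,
    kall (fun u => u = \sum_(x <- L) free_inj x (free_coeff x u)) z.
Proof.
(* Allowing every larger duplicate-free list makes it possible to merge the lists of the two
   components. *)
suff [L H] : exists L : seq K, forall L', uniq L' -> {subset L <= L'} ->
    kall (fun u => u = \sum_(x <- L') free_inj x (free_coeff x u)) z.
  by exists (undup L); apply: H; rewrite ?undup_uniq // => x; rewrite mem_undup.
elim: s z => [|i s IH] z /=.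
  exists (dom z) => L uL sL; rewrite [LHS]free_decomp.
  rewrite [RHS](bigID (mem (dom z))) /= [X in _ + X]big1_seq ?addr0; last first.
    by move=> x /andP[xz _]; rewrite /free_inj /= coeff_outdom // freegU0.
  rewrite -[RHS]big_filter; apply: perm_big; apply: uniq_perm;
    rewrite ?filter_uniq ?uniq_dom //.
  move=> x; rewrite mem_filter; apply/idP/andP => [xz|[]//].
  by split=> //; apply: sL.
have [L1 H1] := IH z.1; have [L2 H2] := IH z.2.
exists (L1 ++ L2) => L uL sL.
by split; [apply: H1|apply: H2] => // x xL; apply: sL; rewrite mem_cat xL ?orbT.
Qed.

End FreeModule.

Section ProjectiveAcyclic.
Import freeg.
Variables (k : fieldType) (n : nat).
Local Notation R := {mpoly k[n]}.
Local Notation triv M := (fun (_ : 'I_1) (_ : M) => True).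

Lemma wgr_triv : wgr (fun=> 0 : 'I_1) = triv ({mpoly k[n]}^o).
Proof. by apply/funext => d; apply/funext => p; apply/propext; split=> // _ m _;
  rewrite !ord1. Qed.

(** [P] is a retract of the free module on its own elements, which is a direct sum of copies of
    [R]. *)
Lemma projective_acyclic (P : lmodType R) s p d :
  projective P -> uniq s -> kvanish (@mvar k n) (fun=> 0) (triv P) (@null _ P) s p.+1 d.
Proof.
move=> projP us.
pose F : lmodType R := {freeg P / R}.
have [|h hP] := projP F P (free_lift id) idfun.
  by move=> u; exists (<< u >>); rewrite free_liftU.
apply: (@kvanish_retract _ _ _ _ _ _ _ h (free_lift id) _ (triv F)) => //.
apply: (kvanish_sum (gr0 := triv R^o) (e := fun=> 0) (pr := @free_coeff R P)
          (inj := @free_inj R P)) => //.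
  exact: free_support.
by move=> a; rewrite -wgr_triv; apply: kos_acyclic.
Qed.

End ProjectiveAcyclic.

(** * Resolutions of a quotient by a monomial ideal *)

Section MonomialQuotient.
Variables (k : fieldType) (n : nat).
Local Notation R := {mpoly k[n]}.
Variables (I : idealr R) (U : pred 'X_{1..n}).
Hypothesis IU : forall p : R, p \in I <-> mideal U p.
Local Notation M := ({ideal_quot I} : lmodType R).
Local Notation s := (enum 'I_n).
Local Open Scope quotient_scope.

Fact pi_linear : linear (\pi_({ideal_quot I}) : R^o -> M).
Proof. by move=> a p q; rewrite rmorphD; congr (_ + _); exact: rmorphM. Qed.

Definition quot_pi : {linear R^o -> M} :=
  HB.pack (\pi_({ideal_quot I}) : R^o -> M) (GRing.isLinear.Build R R^o M _ _ pi_linear).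

Lemma quot_pi_eq0 p : quot_pi p = 0 <-> mideal U p.
Proof.
rewrite -IU -[p in p \in I]subr0 Quotient.idealrBE.
rewrite -[quot_pi p]/(\pi_({ideal_quot I}) (p : R))
  -[0 in X in X <-> _](rmorph0 (\pi_({ideal_quot I}))).
by split=> [->|/eqP->].
Qed.

Lemma quot_pi_surj (u : M) : exists p : R^o, u = quot_pi p.
Proof. by elim/quotW: u => p; exists p. Qed.

Section Gradings.
Variables (D : zmodType) (wt : 'I_n -> D).

Definition quot_gr (d : D) (u : M) : Prop := exists2 p : R^o, wgr wt d p & u = quot_pi p.

Lemma quot_gr_graded : graded (@mvar k n) wt quot_gr.
Proof.
have [g0 gB gX] := @wgr_graded k n D wt;
  split=> [d|d u v [p gp ->] [q gq ->]|d i u [p gp ->]].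
- by exists 0; rewrite ?linear0.
- by exists (p - q); [apply: gB|rewrite linearB].
- by exists (mvar k i *: p); [apply: gX|rewrite linearZ].
Qed.

Lemma kvanish_quot p d :
  kvanish (@mvar k n) wt quot_gr (@null _ M) s p d <->
  kvanish (@mvar k n) wt (wgr wt) (mideal U) s p d.
Proof.
have -> : mideal U = fun p => quot_pi p = 0.
  by apply/funext => q; apply/propext; rewrite quot_pi_eq0.
apply: kvanish_quotient; first exact: wgr_graded.
- by move=> d' q gq; exists q.
- by move=> d' u [q gq ->]; exists q.
Qed.

End Gradings.

Lemma proj_dim_kvanish d i : proj_dim_le M d -> (d < i)%N ->
  kvanish (@mvar k n) (fun=> 0 : 'I_1) (wgr (fun=> 0)) (mideal U) s i 0.
Proof.
move=> [P P0] di; apply/kvanish_quot.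
have -> : quot_gr (fun=> 0 : 'I_1) = fun _ _ => True.
  apply/funext => e; apply/funext => u; apply/propext; split=> // _.
  by have [p ->] := quot_pi_surj u; exists p; rewrite // wgr_triv.
apply: (@resolution_kvanish _ _ _ _ _ (aug_mod M (pr_mod P)) (fun p _ _ => True)
  (aug_map (@pr_diff _ _ P) (pr_aug P))) => //.
- case=> [|p] u /=.
    by apply/(pr_exact0 (p := P)); exists u.
  by apply/(pr_exact (p := P)); exists u.
- case=> [|p] _ u _ /= e.
    by have [v ->] := (pr_exact0 (p := P) u).1 e; exists v.
  by have [v ->] := (pr_exact (p := P) u).1 e; exists v.
- by move=> _ u _; have [v <-] := pr_aug_surj P u; exists v.
- by move=> p i' d'; apply: projective_acyclic; [apply: pr_projective|apply: enum_uniq].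
(* The chains to be bounded have coefficients in [pr_mod P i], which is zero because [d < i]. *)
case: i di => [//|i] di v _; exists 0.
  exact: (@kh0 _ _ (@mvar k n) _ (fun=> 0)).
rewrite linear0; move: v; have := P0 _ di.
elim: s => [|j t IH] H v /=; first exact: H.
by case: v => v1 v2; rewrite (IH H v1) (IH H v2).
Qed.

Definition wt1 (i : 'I_n) : int := 1.

Lemma wdeg1 m : wdeg wt1 m = (mdeg m)%:Z.
Proof.
rewrite mdegE /wdeg (big_morph Posz PoszD (erefl _)).
by apply: eq_bigr => i _; rewrite /wt1 natz.
Qed.

Section Rows.
Variables (q : nat) (dg : 'I_q -> nat).

Definition row_gr (d : int) (v : 'rV[R]_q) : Prop :=
  forall a, wgr wt1 (d - (dg a)%:Z) (v 0 a).

Lemma row_gr_graded : graded (@mvar k n) wt1 row_gr.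
Proof.
have [g0 gB gX] := @wgr_graded k n _ wt1; split=> [d a|d u v gu gv a|d i u gu a].
- by rewrite mxE; apply: g0.
- by rewrite !mxE; apply: gB.
- by rewrite mxE addrAC; apply: (gX _ i (u 0 a)).
Qed.

Lemma row_grP (d : nat) v : row_gr d%:Z v <-> hgr dg d v.
Proof.
split=> gv a m => [/gv|/gv <-]; rewrite wdeg1.
  by move/eqP; rewrite eq_sym subr_eq -PoszD => /eqP[].
by rewrite PoszD addrK.
Qed.

Lemma row_gr_neg (d : nat) v : row_gr (Negz d) v -> v = 0.
Proof.
move=> gv; apply/rowP => a; rewrite mxE; apply/mpolyP => m; rewrite mcoeff0.
apply: memN_msupp_eq0; apply/negP => /gv; rewrite wdeg1 => /eqP.
by rewrite eq_sym subr_eq -PoszD.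
Qed.

Fact coord_linear a : linear (fun v : 'rV[R]_q => v 0 a : R^o).
Proof. by move=> c u v; rewrite !mxE. Qed.

Definition row_coord a : {linear 'rV[R]_q -> R^o} :=
  HB.pack (fun v : 'rV[R]_q => v 0 a : R^o) (GRing.isLinear.Build R _ R^o _ _ (coord_linear a)).

Fact row_delta_linear a : linear (fun c : R^o => (c : R) *: delta_mx 0 a : 'rV[R]_q).
Proof. by move=> c u v; rewrite scalerDl scalerA. Qed.

Definition row_delta a : {linear R^o -> 'rV[R]_q} :=
  HB.pack (fun c : R^o => (c : R) *: delta_mx 0 a : 'rV[R]_q)
    (GRing.isLinear.Build R R^o _ _ _ (row_delta_linear a)).

Lemma row_delta_gr a (d : int) u : wgr wt1 (d - (dg a)%:Z) u -> row_gr d (row_delta a u).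
Proof.
move=> gu b m; rewrite /= !mxE /=; case: eqP => [->|_]; first by rewrite mulr1 => /gu.
by rewrite mulr0 msupp0.
Qed.

Lemma row_decomp (v : 'rV[R]_q) : v = \sum_(a <- enum 'I_q) row_delta a (row_coord a v).
Proof. by rewrite big_enum {1}[v]row_sum_delta. Qed.

Lemma row_acyclic p d :
  kvanish (@mvar k n) wt1 row_gr (@null _ 'rV[R]_q) s p.+1 d.
Proof.
apply: (kvanish_sum (gr0 := wgr wt1) (e := fun a => (dg a)%:Z) (pr := row_coord)
          (inj := row_delta)); first exact: row_gr_graded.
- by move=> a d' u; apply: row_delta_gr.
- by move=> a d' u /(_ a).
- by move=> z; exists (enum 'I_q); apply: kall_all => u; apply: row_decomp.
- by move=> a; apply/kos_acyclic/enum_uniq.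
Qed.

Definition row_const0 (v : 'rV[R]_q) : Prop := forall a, (v 0 a)@_0%MM = 0.

Lemma submod_row_const0 : submod row_const0.
Proof.
split=> [a|u v u0 v0 a|c u u0 a]; first by rewrite mxE mcoeff0.
  by rewrite !mxE mcoeffB u0 v0 subrr.
by rewrite mxE rmorphM /= u0 mulr0.
Qed.

Lemma row_const0X i u : row_const0 (mvar k i *: u).
Proof. by move=> a; rewrite mxE rmorphM /= mcoeffX mnm1_eq0 mul0r. Qed.

Lemma row_boundary0 d (z : kos ('rV[R]_q : lmodType R) s) :
  kh wt1 row_gr 0 d z -> kall row_const0 z ->
  exists2 w, kh wt1 row_gr 1 d w & z = kdiff (@mvar k n) w.
Proof.
move=> hz z0; apply: (kboundary_sum (gr0 := wgr wt1) (e := fun a => (dg a)%:Z)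
   (pr := row_coord) (inj := row_delta) row_gr_graded
   (fun a d' u => @row_delta_gr a d' u) (L := enum 'I_q)).
  by apply: kall_all => u; apply: row_decomp.
move=> a; apply: kos_boundary0.
  by apply: (kmap_kh _ hz) => d' u /(_ a).
apply/kall_map; apply: kall_imp z0 => u /(_ a) u0 m um.
apply/hasP; have [m0|m_neq0] := eqVneq m 0%MM.
  by move: um; rewrite m0 mcoeff_msupp /= u0 eqxx.
have [i mi] : exists i, m i != 0%N.
  apply/existsP; apply: contraR m_neq0 => /existsPn H; apply/eqP/mnmP => i.
  by rewrite mnm0E; apply/eqP; have := H i; rewrite negbK.
by exists i; rewrite ?mem_enum // lt0n.
Qed.

End Rows.

Section Betti.
Variable gr : nat -> M -> Prop.
Hypothesis grE : forall d u, gr d u <-> quot_gr wt1 d%:Z u.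
Variable F : min_graded_free_resolution gr.

Let P p : lmodType R := 'rV[R]_(gf_rank F p).
Let Q := aug_mod M P.
Let g : forall p, {linear Q p.+1 -> Q p} :=
  @aug_map R M P (fun p => mulmxr (gf_diff F p)) (gf_aug F).
Let grQ p : int -> Q p -> Prop :=
  match p return int -> Q p -> Prop with
  | 0%N => quot_gr wt1
  | p'.+1 => row_gr (@gf_deg _ _ _ _ F p')
  end.

Let diff_hgr p b : hgr (@gf_deg _ _ _ _ F p) (@gf_deg _ _ _ _ F p.+1 b) (row b (gf_diff F p)).
Proof.
move=> a m; rewrite mxE; case: (gf_diff_homog b a) => [->|[d -> /dhomogP H /H <-]].
  by rewrite msupp0.
by rewrite addnC.
Qed.

Let aug_gr d v : row_gr (@gf_deg _ _ _ _ F 0) d v -> quot_gr wt1 d (gf_aug F v).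
Proof.
move=> gv; rewrite [v]row_sum_delta linear_sum.
have [g0 gB _] := quot_gr_graded wt1.
have gD u w : quot_gr wt1 d u -> quot_gr wt1 d w -> quot_gr wt1 d (u + w).
  by move=> gu gw; rewrite -[w]opprK -[- w]sub0r; apply: (gB) => //; apply: gB.
elim: (index_enum _) => [|a t IH]; first by rewrite big_nil; apply: g0.
rewrite big_cons; apply: gD IH; rewrite linearZ /=.
have /grE[q gq ->] := @gf_aug_homog _ _ _ _ F a.
exists (v 0 a *: q); last by rewrite linearZ.
move=> m; rewrite -[v 0 a *: q]/(v 0 a * (q : R)) => /msuppM_le /allpairsP[[m1 m2] /= [m1v m2q ->]].
by rewrite wdegD (gq _ m2q) (gv _ _ m1v) subrK.
Qed.

Let g_complex p u : g p (g p.+1 u) = 0.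
Proof.
case: p u => [|p] u /=.
  by apply/(@gf_exact0 _ _ _ _ F); exists u.
by apply/(@gf_exact _ _ _ _ F p); exists u.
Qed.

Let gr_g p d u : grQ (p := p.+1) d u -> grQ d (g p u).
Proof.
case: p u => [|p] u /=; first exact: aug_gr.
case: d => d; last by move/row_gr_neg => ->; rewrite mul0mx => a m; rewrite mxE msupp0.
by move/row_grP => gu; apply/row_grP; apply: hgr_mulmx gu.
Qed.

Let row_lift p d (v : 'rV[R]_(gf_rank F p)) (y : 'rV[R]_(gf_rank F p.+1)) :
  row_gr (@gf_deg _ _ _ _ F p) d v -> v = y *m gf_diff F p ->
  exists2 y', row_gr (@gf_deg _ _ _ _ F p.+1) d y' & v = y' *m gf_diff F p.
Proof.
case: d => d gv ev; last first.
  by exists 0; rewrite ?mul0mx ?(row_gr_neg gv) // => a m; rewrite mxE msupp0.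
exists (hcomp (@gf_deg _ _ _ _ F p.+1) d y); first exact/row_grP/hgr_hcomp.
rewrite -(hcomp_mulmx _ _ (@diff_hgr p)) -ev.
by move/row_grP: gv => /(hcomp_id d) ->; rewrite eqxx.
Qed.

Let g_exact p d (u : Q p.+1) : grQ d u -> g p u = 0 ->
  exists2 v, grQ d v & u = g p.+1 v.
Proof.
case: p u => [|p] u /= gu.
  by move/(@gf_exact0 _ _ _ _ F) => [y ey]; apply: row_lift gu ey.
by move/(@gf_exact _ _ _ _ F p) => [y ey]; apply: row_lift gu ey.
Qed.

Let grQ_graded p : graded (@mvar k n) wt1 (@grQ p).
Proof. by case: p => [|p]; [apply: quot_gr_graded|apply: row_gr_graded]. Qed.

Let g_surj (d : int) (u : Q 0) : grQ d u -> exists2 v, grQ (p := 1) d v & u = g 0 v.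
Proof.
case: d => d [q gq ->]; last first.
  have -> : q = 0.
    apply/mpolyP => m; rewrite mcoeff0; apply: memN_msupp_eq0; apply/negP.
    by move=> /gq; rewrite wdeg1.
  exists 0; last by rewrite !linear0.
  by move=> a m; rewrite mxE msupp0.
have /choice[c cP] : forall a, exists c : R^o,
    wgr wt1 (gf_deg (m := F) (i := 0) a)%:Z c /\ gf_aug F (delta_mx 0 a) = quot_pi c.
  by move=> a; have /grE[c gc ->] := @gf_aug_homog _ _ _ _ F a; exists c.
pose A : 'M[R]_(gf_rank F 0, 1) := \col_a c a.
have augE (y : 'rV[R]_(gf_rank F 0)) : gf_aug F y = quot_pi ((y *m A) 0 0).
  rewrite {1}[y]row_sum_delta linear_sum mxE linear_sum; apply: eq_bigr => a _.
  have [_ e] := cP a.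
  by rewrite linearZ /= e mxE [RHS]rmorphM.
have hA b : hgr (fun=> 0%N) (@gf_deg _ _ _ _ F 0 b) (row b A).
  move=> a m; rewrite mxE mxE addn0 => mc; have [gc _] := cP b.
  by have := gc m mc; rewrite wdeg1 => -[].
have [y ey] := gf_aug_surj F (quot_pi q).
(* Replacing a preimage by its degree-[d] component is harmless: the resulting difference with [q]
   is the degree-[d] part of an element of the monomial ideal. *)
exists (hcomp (@gf_deg _ _ _ _ F 0) d y); first exact/row_grP/hgr_hcomp.
rewrite -[g 0 _]/(gf_aug F _) augE -(hcomp_mulmx _ _ hA); move: ey;
  rewrite augE => /esym/eqP.
rewrite -subr_eq0 -linearB => /eqP/quot_pi_eq0 Uq.
apply/eqP; rewrite -subr_eq0 -linearB; apply/eqP/quot_pi_eq0 => m.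
rewrite mxE mcoeff_msupp mcoeffB mcoeff_mpick addn0.
have := Uq m; rewrite mcoeff_msupp mcoeffB.
have [md|md] := eqVneq (mdeg m) d; first by [].

rewrite subr0 => _; rewrite -mcoeff_msupp => /gq; rewrite wdeg1 => -[md'].
by rewrite md' eqxx in md.
Qed.

Let Q_acyclic p i d : kvanish (@mvar k n) wt1 (@grQ p.+1) (@null _ (Q p.+1)) s i.+1 d.
Proof. exact: row_acyclic. Qed.

(** A chain of Koszul degree 0 and internal degree [j] over the [i]-th free module could have a
    constant term only at a generator of degree [j]. Without constant terms it is a boundary, and
    [resolution_kvanish] applies. *)
Lemma betti_vanish i (j : nat) : (forall a : 'I_(gf_rank F i), gf_deg a != j) ->
  kvanish (@mvar k n) wt1 (wgr wt1) (mideal U) s i j%:Z.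
Proof.
move=> ne; apply/kvanish_quot.
apply: (resolution_kvanish (Q := Q) (gr := grQ) (g := g)) => //.
move=> v hv; apply: row_boundary0 => //.
apply: kall_kh0 hv; first by move=> a; rewrite mxE mcoeff0.
move=> u gu a; apply: memN_msupp_eq0; apply/negP => /gu;
  rewrite wdeg1 mdeg0 => /esym/eqP.
by rewrite subr_eq0 eq_sym => /eqP[e]; have := ne a; rewrite e eqxx.
Qed.

(** Vanishing would write the basis vector of [a] as a Koszul boundary plus an element of the image
    of the next differential. Neither has a constant term, the second by minimality, whereas the
    basis vector has one. *)
Lemma betti_nonvanish i (a : 'I_(gf_rank F i)) :
  ~ kvanish (@mvar k n) wt1 (wgr wt1) (mideal U) s i (gf_deg a)%:Z.
Proof.
move/kvanish_quot => V.
pose e : 'rV[R]_(gf_rank F i) := delta_mx 0 a.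
have ge : grQ (p := i.+1) (gf_deg a)%:Z e.
  apply/row_grP => b m; rewrite mxE /=; case: eqP => [->|_]; last by rewrite msupp0.
  by rewrite msupp1 inE => /eqP->; rewrite mdeg0.
pose u : kos (Q i.+1) s := kconst s (e : Q i.+1).
have hu : kh wt1 (@grQ i.+1) 0 (gf_deg a)%:Z u by apply: kconst_kh.
have du : kdiff (@mvar k n) u = 0 by apply: (kdiff_kh0 _ hu).
have [|||v [w [hv hw]]] := resolution_descend (Q := Q) (gr := grQ) (g := g) (x := @mvar k n)
  (wt := wt1) (i := 0) (p := i) (u := u) grQ_graded gr_g g_complex g_exact g_surj Q_acyclic _ hu.
- by rewrite addn0.
- by rewrite du linear0.
- clear V; case: i a @e ge @u hu du => [//|i] a e ge u hu du _.
  apply: row_boundary0; first by apply: (kmap_kh0 _ hu) => d' u'; apply: gr_g.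
  apply/kall_map; rewrite /u.
  have H : row_const0 (g i.+1 (e : Q i.+2)).
    by move=> b; rewrite /= /e -rowE mxE gf_minimal.
  have H0 : row_const0 (g i.+1 (0 : Q i.+2)).
    by move=> b; rewrite linear0 mxE mcoeff0.
  have {}H0 t : kall (fun u => row_const0 (g i.+1 u)) (0 : kos (Q i.+2) t).
    by elim: t => [|l t IH] //=; split.
  by elim: s => [|l t IH] //=; split.
move=> ue; have : kall (@row_const0 (gf_rank F i)) u.
  rewrite ue; apply: (submod_add (kall_submod _ (@submod_row_const0 _))).
    by apply: kall_boundary; [apply: submod_row_const0|apply: row_const0X].
  apply/kall_map; apply: kall_all => y b; rewrite /= mxE raddf_sum big1 // => l _.
  by rewrite /= rmorphM /= gf_minimal mulr0.
move/kall_kconst => /(_ a); rewrite mxE !eqxx mcoeff1 eqxx => /eqP.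
by rewrite oner_eq0.
Qed.

End Betti.
End MonomialQuotient.

(** * Koszul homology of edge ideals *)

Section EdgeIdeals.
Variables (k : fieldType) (n : nat) (e : rel 'I_n).
Hypotheses (e_sym : ssrbool.symmetric e) (e_irr : irreflexive e).
Implicit Types (T W : {set 'I_n}) (m : 'X_{1..n}) (x y u v : 'I_n).
Local Notation R := {mpoly k[n]}.
Local Notation s := (enum 'I_n).

Definition nbrs x : {set 'I_n} := [set y | e x y].

(* The monomials of the ideal generated by the edge ideal and the variables in
   [T]; [T] plays the role of a set of deleted vertices. *)
Definition eset T : pred 'X_{1..n} := fun m =>
  [exists v in T, 0 < m v]%N || [exists u, exists v, [&& e u v, 0 < m u & 0 < m v]]%N.

Lemma esetP T m : reflect
  ((exists2 v, v \in T & 0 < m v)%N \/ exists u v, [/\ e u v, 0 < m u & 0 < m v]%N)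
  (eset T m).
Proof.
apply: (iffP orP) => -[].
- by case/existsP=> v /andP[vT mv]; left; exists v.
- by case/existsP=> u /existsP[v /and3P[? ? ?]]; right; exists u, v.
- by case=> v vT mv; left; apply/existsP; exists v; rewrite vT.
- case=> u [v [uv mu mv]]; right; apply/existsP; exists u; apply/existsP; exists v.
  exact/and3P.
Qed.

Lemma eset_upset T : upset (eset T).
Proof.
have pos m m' v : (0 < m v)%N -> (0 < (m + m')%MM v)%N by rewrite mnmDE addn_gt0 => ->.
move=> m m' /esetP[[v vT mv]|[u [v [uv mu mv]]]]; apply/esetP.
  by left; exists v; rewrite ?pos.
by right; exists u, v; rewrite !pos.
Qed.
Hint Resolve eset_upset : core.

Lemma eset_addvar T x : addvar (eset T) x =1 eset (x |: T).
Proof.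
move=> m; apply/orP/esetP => [[/esetP[[v vT mv]|uv]|mx]|[[v]|uv]].
- by left; exists v; rewrite // !inE vT orbT.
- by right.
- by left; exists x; rewrite ?setU11.
- rewrite !inE => /orP[/eqP->|vT] mv; first by right.
  by left; apply/esetP; left; exists v.
- by left; apply/esetP; right.
Qed.

Lemma eset_colon T x : x \notin T -> colon (eset T) x =1 eset (T :|: nbrs x).
Proof.
move=> xT m; have mx v : v != x -> (m + U_(x))%MM v = m v.
  by move=> vx; rewrite mnmDE mnm1E eq_sym (negPf vx) addn0.
have ex v : e x v -> v != x by apply: contraTneq => ->; rewrite e_irr.
apply/idP/idP => [/esetP[[v vT mv]|[u [v [uv mu mv]]]]|].
- apply/esetP; left; exists v; rewrite ?inE ?vT //.
  by rewrite mx in mv => //; apply: contraNneq xT => <-.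
- have [ux|ux] := eqVneq u x.
    rewrite {}ux in uv; apply/esetP; left; exists v; first by rewrite !inE uv orbT.
    by rewrite mx in mv => //; apply: ex.
  have [vx|vx] := eqVneq v x.
    rewrite {}vx e_sym in uv; apply/esetP; left; exists u;
      first by rewrite !inE uv orbT.
    by rewrite mx in mu.
  by apply/esetP; right; exists u, v; rewrite !mx in mu mv.
case/esetP=> [[v]|[u [v [uv mu mv]]]].
  rewrite !inE => /orP[vT|xv] mv.
    by apply: eset_upset; apply/esetP; left; exists v.
  apply/esetP; right; exists x, v; split=> //; last by rewrite mx ?ex.
  by rewrite mnmDE mnm1E eqxx addn1.
by apply: eset_upset; apply/esetP; right; exists u, v.
Qed.

(** For [c] outside [T], having [x_c m] in the ideal means that [m] is already there or contains a
    neighbour [v] of [c]. In the latter case [x_v m] has the same support as [m], and membership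
    depends on the support alone. *)
Lemma eset_socle T m : T != [set: 'I_n] ->
  {in s, forall i, eset T (m + U_(i))%MM} -> eset T m.
Proof.
rewrite -subTset => /subsetPn[c _ cT] H.
have := H c; rewrite mem_enum => /(_ isT) => Hc.
have := eset_colon cT m; rewrite /colon Hc => /esym/esetP[[v]|[u [v uv]]]; last first.
  by apply/esetP; right; exists u, v.
rewrite !inE => /orP[vT|cv] mv; first by apply/esetP; left; exists v.
have pos w : (0 < (m + U_(v))%MM w)%N -> (0 < m w)%N.
  by rewrite mnmDE mnm1E; case: eqP => [<- //|_]; rewrite addn0.
have := H v; rewrite mem_enum => /(_ isT) /esetP[[w wT mw]|[w [w' [ww' mw mw']]]].
  by apply/esetP; left; exists w => //; apply: pos.
by apply/esetP; right; exists w, w'; split=> //; apply: pos.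
Qed.

Lemma eset_kvanish_top T (D : zmodType) (wt : 'I_n -> D) p d : T != [set: 'I_n] -> (n <= p)%N ->
  kvanish (@mvar k n) wt (wgr wt) (mideal (eset T)) s p d.
Proof.
move=> neT; have szs : size s = n by rewrite size_enum_ord.
rewrite leq_eqVlt => /orP[/eqP<-|np]; last first.
  apply: kvanish_big; [exact: wgr_graded|exact: submod_mideal|by rewrite szs].
rewrite -[n in kvanish _ _ _ _ _ n]szs.
by apply: kvanish_socle => // m; apply: eset_socle.
Qed.

Lemma eset0_join A : A != set0 -> A != [set: 'I_n] ->
  (forall a b, a \in A -> b \notin A -> e a b) ->
  ~ kvanish (@mvar k n) (fun=> 0 : 'I_1) (wgr (fun=> 0)) (mideal (eset set0)) s n.-1 0.
Proof.
move=> A0 AT eA; have n_gt0 : (0 < n)%N.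
  by case/set0Pn: A0 => a _; apply: leq_ltn_trans (ltn_ord a).
(* A monomial involving both [A] and its complement is divisible by an edge across the cut, so the
   two ideals meet in the edge ideal. *)
have EI : predI (eset A) (eset (~: A)) =1 eset set0.
  move=> m; apply/andP/esetP => [[/esetP[[a aA ma]|uv]]|[[v]|uv]]; last 2 first.
  - by rewrite inE.
  - by split; apply/esetP; right.
  - case/esetP=> [[b bA mb]|uv]; right => //; exists a, b; split=> //.
    by apply: eA => //; rewrite inE in bA.
  - by right.
have EU : predU (eset A) (eset (~: A)) =1 eset [set: 'I_n].
  move=> m; apply/orP/esetP => [[]/esetP[[v _ mv]|[u [v [_ mu _]]]]|[[v _ mv]|uv]].
  - by left; exists v.
  - by left; exists u.
  - by left; exists v.
  - by left; exists u.
  - by have [vA|vA] := boolP (v \in A); [left|right]; apply/esetP; left; exists v;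
    rewrite ?inE.
  - by left; apply/esetP; right.
move=> V; have nE : n.-1.+1 = n by rewrite prednK.
have V' : kvanish (@mvar k n) (fun=> 0 : 'I_1) (wgr (fun=> 0))
    (mideal (eset [set: 'I_n])) s n.-1.+1 0.
  apply: (kvanish_eq EU); apply: les_union => //.
  - by apply: (kvanish_eq (fun m => esym (EI m))).
  - by apply: eset_kvanish_top; rewrite ?nE.
  - apply: eset_kvanish_top; rewrite ?nE //.
    by apply: contraNneq A0 => AE; rewrite -[A]setCK AE setCT.
have cn : count xpredT s = n.-1.+1 by rewrite count_predT size_enum_ord nE.
rewrite -cn in V'; apply: (kvanish_top _ _ _ _ _ V').
- exact: eset_upset.
- by apply/negP => /esetP[[v _]|[u [v [_]]]]; rewrite mnm0E.
- by move=> i _; apply/esetP; left; exists i; rewrite ?inE // mnm1E eqxx.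
- by rewrite !ord1.
- by move=> w; apply: kh_big; rewrite count_predT.
Qed.

(** * Regularity of bipartite graphs *)

Definition reg_le (U : pred 'X_{1..n}) (r : nat) : Prop :=
  forall p (d : int), ((p + r)%N%:Z < d)%R ->
    kvanish (@mvar k n) (@wt1 n) (wgr (@wt1 n)) (mideal U) s p d.

Lemma reg_le_mono U r r' : (r <= r')%N -> reg_le U r -> reg_le U r'.
Proof.
by move=> rr' H p d lt_d; apply: H; apply: le_lt_trans lt_d; rewrite lez_nat leq_add2l.
Qed.

Lemma reg_le_vars t : reg_le (mvars t) 0.
Proof.
have mvars_nil : mideal (mvars [::]) = @null _ R^o.
  apply/funext => q; apply/propext; split=> [q0|-> m];
    last by rewrite -[0]/(0 : R) msupp0.
  by apply/mpolyP => m; rewrite mcoeff0; apply: memN_msupp_eq0; apply/negP => /q0.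
elim: t => [|i t IH] p d; rewrite addn0 => pd.
  rewrite mvars_nil; case: p pd => [|p] pd; last exact/kos_acyclic/enum_uniq.
  apply/kvanish_nullP => z hz _; apply: kos_boundary0 => //.
  apply: kall_kh0 hz => [m|u gu m /gu]; first by rewrite -[0]/(0 : R) msupp0.
  rewrite wdeg1 => md; apply: contraT => /hasPn m0; move: pd; rewrite -md.
  have -> : m = 0%MM.
    apply/mnmP => j; rewrite mnm0E; apply/eqP; have := m0 j.
    by rewrite mem_enum -leqNgt leqn0 => ->.
  by rewrite mdeg0.
have E : mvars (i :: t) =1 addvar (mvars t) i by move=> m;
  rewrite /addvar /mvars /= orbC.
have [it|it] := boolP (i \in t).
  apply: (@kvanish_eq _ _ _ _ (mvars t)); last by apply: IH; rewrite addn0.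
  move=> m; rewrite E /addvar; case: (boolP (mvars t m)) => //= mt.
  by apply/esym/negbTE; apply: contra mt => mi; apply/hasP; exists i.
apply: (kvanish_eq (fun m => esym (E m))).
case: p pd => [|p] pd; first by apply: (les_quo0 (@upset_mvars n t)); apply: IH;
  rewrite addn0.
apply: les_quo; [exact: upset_mvars|by apply: IH; rewrite addn0|].
have Ec : colon (mvars t) i =1 mvars t.
  move=> m; apply/hasP/hasP => -[j jt mj]; exists j => //.
    move: mj; rewrite mnmDE mnm1E; have [ij|_] := eqVneq i j; last by rewrite addn0.
    by rewrite ij jt in it.
  by rewrite mnmDE addn_gt0 mj.
apply: (kvanish_eq (fun m => esym (Ec m))); apply: IH.
by rewrite addn0 /wt1 ltrBrDr -PoszD addn1.
Qed.

Lemma reg_le_step T x r : x \notin T ->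
  reg_le (eset (T :|: nbrs x)) r -> reg_le (eset (x |: T)) r.+1 -> reg_le (eset T) r.+1.
Proof.
move=> xT H1 H2 p d pd; apply: (@les_mid _ _ _ _ _ x) => //.
  apply: (kvanish_eq (fun m => esym (eset_colon xT m))); apply: H1.
  by rewrite /wt1 ltrBrDr -PoszD addn1 -addnS.
by apply: (kvanish_eq (fun m => esym (eset_addvar T x m))); apply: H2.
Qed.

Section Bipartite.
Variable A : {set 'I_n}.
Hypothesis bip : forall x y, e x y -> (x \in A) = (y \notin A).

(** Every edge that survives the removal of [T] has its end in [A] here, so this set measures what
    is left and its size drives the inductions. *)
Definition live T : {set 'I_n} := [set a in A :\: T | ~~ (nbrs a \subset T)].

Lemma reg_le_dead T : live T = set0 -> reg_le (eset T) 0.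
Proof.
move=> T0; have dead u v : e u v -> u \in A -> (u \in T) || (v \in T).
  move=> uv uA; apply: contraT; rewrite negb_or => /andP[uT vT].
  have : u \in live T; last by rewrite T0 inE.
  by rewrite !inE uT uA /=; apply/subsetPn; exists v; rewrite ?inE.
have E : eset T =1 mvars (enum T).
  move=> m; apply/esetP/hasP => [[[v vT mv]|[u [v [uv mu mv]]]]|[v]].
  - by exists v; rewrite ?mem_enum.
  - have [uA|uA] := boolP (u \in A).
      by have /orP[uT|vT] := dead u v uv uA; [exists u|exists v]; rewrite ?mem_enum.
    have vA : v \in A by apply: contraNT uA; rewrite (bip uv).
    rewrite e_sym in uv; have /orP[vT|uT] := dead v u uv vA; [exists v|exists u];
      by rewrite ?mem_enum.
  - by rewrite mem_enum => vT mv; left; exists v.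
move=> p d pd; apply: (kvanish_eq (fun m => esym (E m))); exact: reg_le_vars.
Qed.

Lemma live_nbrs T x : x \in live T -> live (T :|: nbrs x) \proper live T.
Proof.
move=> xl; apply/properP; split.
  apply/subsetP => a; rewrite !inE negb_or => /andP[/andP[/andP[-> _] ->] /=].
  by apply: contra => /subset_trans; apply; apply: subsetUl.
by exists x => //; rewrite !inE subsetUr andbF.
Qed.

Lemma live_del T x : x \in live T -> live (x |: T) \proper live T.
Proof.
move=> xl; apply/properP; split.
  apply/subsetP => a; rewrite !inE negb_or => /andP[/andP[/andP[_ ->] ->] /=].
  by apply: contra => /subset_trans; apply; apply: subsetUr.
by exists x => //; rewrite !inE eqxx.
Qed.

Lemma live_notin T x : x \in live T -> x \notin T.
Proof. by rewrite !inE => /andP[/andP[]]. Qed.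

Lemma reg_le_live T c : (#|live T| <= c)%N -> reg_le (eset T) c.
Proof.
elim: c T => [|c IH] T.
  by rewrite leqn0 cards_eq0 => /eqP; apply: reg_le_dead.
have [T0 _|/set0Pn[x xl] Tc] := eqVneq (live T) set0.
  by apply: (@reg_le_mono _ 0) => //; apply: reg_le_dead.
apply: (reg_le_step (live_notin xl)).
  by apply: IH; rewrite -ltnS; apply: leq_trans (proper_card (live_nbrs xl)) Tc.
apply: (@reg_le_mono _ c) => //; apply: IH; rewrite -ltnS.
exact: leq_trans (proper_card (live_del xl)) Tc.
Qed.

Definition no_leaf T : Prop := forall a b, a \in A -> a \notin T -> b \notin T -> e a b ->
  exists2 a', a' != a & [/\ a' \in A, a' \notin T & e a' b].

(** Passing to the link of [x] removes only vertices outside [A], so [no_leaf] persists and the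
    induction applies. Deleting [x] may create leaves, but that term is not shifted, and with one
    live vertex fewer the weaker bound [reg_le_live] is enough. *)
Lemma reg_le_no_leaf T c : no_leaf T -> (#|live T| <= c.+1)%N -> reg_le (eset T) c.
Proof.
elim: c T => [|c IH] T noleaf Tc.
  (* A live vertex has a surviving neighbour, whose second neighbour in [A] is live too; a single
     live vertex is therefore impossible. *)
  apply: reg_le_dead; apply/eqP; apply: contraT => /set0Pn[x xl].
  have := xl; rewrite !inE => /andP[/andP[xT xA] /subsetPn[b]]; rewrite inE => xb bT.
  have [x' x'x [x'A x'T x'b]] := noleaf x b xA xT bT xb.
  suff : (1 < #|live T|)%N by rewrite ltnNge Tc.
  rewrite (cardD1 x) xl (cardD1 x') !inE x'x x'T x'A /=.
  rewrite (_ : ~~ _ = true) //; apply/subsetPn; exists b; rewrite ?inE //.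
have [T0|/set0Pn[x xl]] := eqVneq (live T) set0.
  by apply: (@reg_le_mono _ 0) => //; apply: reg_le_dead.
apply: (reg_le_step (live_notin xl)).
  apply: IH; last by rewrite -ltnS; apply: leq_trans (proper_card (live_nbrs xl)) Tc.
  have xA : x \in A by move: xl; rewrite !inE => /andP[/andP[]].
  move=> a b aA; rewrite !inE !negb_or => /andP[aT xa] /andP[bT xb] ab.
  have [a' a'a [a'A a'T a'b]] := noleaf a b aA aT bT ab.
  exists a' => //; split=> //; rewrite !inE negb_or a'T /=.
  by apply: contraL a'A => /bip <-.
apply: reg_le_live; rewrite -ltnS.
exact: leq_trans (proper_card (live_del xl)) Tc.
Qed.

End Bipartite.
End EdgeIdeals.

(** * Squarefree degrees *)

Section Squarefree.
Variables (k : fieldType) (n : nat) (e : rel 'I_n).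
Hypotheses (e_sym : ssrbool.symmetric e) (e_irr : irreflexive e).
Implicit Types (T W : {set 'I_n}) (m : 'X_{1..n}) (x y u v : 'I_n).
Local Notation R := {mpoly k[n]}.
Local Notation s := (enum 'I_n).
Local Notation D := {ffun 'I_n -> int}.
Local Notation eset := (eset e).
Local Notation nbrs := (nbrs e).

Definition fine_wt (i : 'I_n) : D := [ffun j => (i == j)%:Z].
Definition fine_deg W : D := [ffun j => (j \in W)%:Z].

Fact fine_coord_additive c : additive (fun f : D => f c).
Proof. by move=> f g; rewrite !ffunE. Qed.
Definition fine_coord c : {additive D -> int} :=
  HB.pack (fun f : D => f c) (GRing.isAdditive.Build D int _ (fine_coord_additive c)).

Fact fine_total_additive : additive (fun f : D => \sum_c f c).
Proof. by move=> f g; rewrite -sumrB; apply: eq_bigr => c _; rewrite !ffunE. Qed.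
Definition fine_total : {additive D -> int} :=
  HB.pack (fun f : D => \sum_c f c) (GRing.isAdditive.Build D int _ fine_total_additive).

Lemma fine_total_wt i : fine_total (fine_wt i) = 1.
Proof.
rewrite /= (bigD1 i) //= big1 => [|j ji]; first by rewrite ffunE eqxx.
by rewrite ffunE eq_sym (negPf ji).
Qed.

Lemma fine_total_deg W : fine_total (fine_deg W) = #|W|%:Z.
Proof.
rewrite /= -sum1_card (big_morph Posz PoszD (erefl _)) [RHS]big_mkcond.
by apply: eq_bigr => c _; rewrite ffunE; case: (c \in W).
Qed.

Lemma fine_coord_wdeg c m : fine_coord c (wdeg fine_wt m) = m c.
Proof.
rewrite raddf_sum (bigD1 c) // big1 => [|i ic].
  by rewrite raddfMn /= ffunE eqxx addr0 natz.
by rewrite raddfMn /= ffunE (negPf ic) mul0rn.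
Qed.

Lemma fine_degD1 W x : x \in W -> fine_deg W - fine_wt x = fine_deg (W :\ x).
Proof.
move=> xW; apply/ffunP => c; rewrite !ffunE !inE eq_sym.
by case: eqP => [->|_] /=; rewrite ?xW ?subrr ?subr0.
Qed.

(** By Hochster's formula: the reduced homology, in dimension [#|W| - p - 1], of the independence
    complex of the graph induced on [W] minus [T] vanishes. *)
Definition fvan T W p : Prop :=
  kvanish (@mvar k n) fine_wt (wgr fine_wt) (mideal (eset T)) s p (fine_deg W).

(** The colon term lives in a degree with entry -1 at [x], where there are no chains. *)
Lemma fvan_outside T W x p : x \notin W -> fvan T W p -> fvan (x |: T) W p.
Proof.
move=> xW V; apply: (kvanish_eq (eset_addvar e T x)).
case: p V => [|p] V; first exact: (les_quo0 (@eset_upset n e T)).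
apply: les_quo => //; first exact: eset_upset.
move=> z hz _; suff -> : z = 0.
  exists 0; first exact: (kh0 (@wgr_graded k n _ fine_wt)).
  rewrite linear0 subr0.
  by have [] := kall_submod s (@submod_mideal k n _ (@upset_colon n _ x (@eset_upset n e T))).
apply: (@kh_negative k n D fine_wt (fine_coord x) 0 s p _ z _ _ hz).
  by move=> i; rewrite /= ffunE; case: (_ == _).
by rewrite raddfB /= !ffunE eqxx (negPf xW).
Qed.

Lemma fvan_link T W x p : x \in W -> x \notin T ->
  fvan T W p -> fvan (x |: T) W p.+1 -> fvan (T :|: nbrs x) (W :\ x) p.
Proof.
move=> xW xT V1 V2; apply: (kvanish_eq (eset_colon e_sym e_irr xT)).
rewrite -fine_degD1 //; apply: les_sub => //; first exact: eset_upset.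
exact: (kvanish_eq (fun m => esym (eset_addvar e T x m))).
Qed.

Lemma fvan_del T W x p : x \in W -> x \notin T ->
  fvan T W p -> (forall q, fvan (T :|: nbrs x) (W :\ x) q) -> fvan (x |: T) W p.
Proof.
move=> xW xT V1 V2; apply: (kvanish_eq (eset_addvar e T x)).
case: p V1 => [|p] V1; first exact: (les_quo0 (@eset_upset n e T)).
apply: les_quo => //; first exact: eset_upset.
apply: (kvanish_eq (fun m => esym (eset_colon e_sym e_irr xT m))).
by rewrite fine_degD1 //; apply: V2.
Qed.

Lemma fvan_split T W x p : x \in W -> x \notin T ->
  fvan (T :|: nbrs x) (W :\ x) p -> fvan (x |: T) W p -> fvan T W p.
Proof.
move=> xW xT V1 V2; apply: (@les_mid _ _ _ _ _ x); first exact: eset_upset.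
  apply: (kvanish_eq (fun m => esym (eset_colon e_sym e_irr xT m))).
  by rewrite fine_degD1.
exact: (kvanish_eq (fun m => esym (eset_addvar e T x m))).
Qed.

Lemma fvan_cone T W c p : c \in W -> c \notin T -> nbrs c \subset T -> fvan T W p.
Proof.
move=> cW cT cN; apply: (@kvanish_cone _ _ _ _ (fine_coord c) _ c).
- exact: eset_upset.
- exact: fine_coord_wdeg.
- by move=> m; rewrite (eset_colon e_sym e_irr cT) (setUidPl cN).
- exact: enum_uniq.
- by rewrite mem_enum.
- by rewrite /= ffunE cW.
Qed.

(* In topological terms: if [N(u)] is contained in [N(v)], then removing [v]
   does not change the homotopy type of the independence complex. *)
Lemma fvan_fold T W u v p : u \in W -> u \notin T -> v \in W -> v \notin T ->
  u != v -> ~~ e v u -> nbrs u \subset T :|: nbrs v ->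
  fvan (v |: T) W p -> fvan T W p.
Proof.
move=> uW uT vW vT uv vu sN; apply: fvan_split => //.
by apply: (fvan_cone _ (c := u)); rewrite // !inE ?uv ?uW // negb_or uT.
Qed.

(** Only the empty face remains: the sphere of dimension -1. *)
Lemma fvan_killed T W : W \subset T -> ~ fvan T W #|W|.
Proof.
move=> sWT; have cW : count (mem W) s = #|W|.
  by rewrite -sum1_count big_enum_cond -sum1_card; apply: eq_bigl.
rewrite /fvan -cW; apply: kvanish_top.
- exact: eset_upset.
- by apply/negP => /esetP[[v _]|[u [v [_]]]]; rewrite mnm0E.
- by move=> i iW; apply/esetP; left; exists i; rewrite ?mnm1E ?eqxx // (subsetP sWT).
- apply/ffunP => c; rewrite sum_ffunE ffunE big_enum_cond /=.
  have [cW'|cW'] := boolP (c \in W).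
    rewrite (bigD1 c) //= ffunE eqxx big1 ?addr0 // => i /andP[_ ic].
    by rewrite ffunE (negPf ic).
  rewrite big1 // => i iW; rewrite ffunE; case: eqP => // ic.
  by rewrite ic (negPf cW') in iW.
move=> w; rewrite cW; apply: (@kh_negative k n D fine_wt fine_total 1).
  by move=> i; rewrite fine_total_wt.
by rewrite fine_total_deg mul1n ltz_nat.
Qed.

Lemma fvan_total T W p :
  kvanish (@mvar k n) (@wt1 n) (wgr (@wt1 n)) (mideal (eset T)) s p #|W|%:Z ->
  fvan T W p.
Proof.
rewrite -fine_total_deg; apply: kvanish_refine => i.
exact: fine_total_wt.
Qed.

(** The neighbours [y] of [c] are folded away one after the other, each against its [u]. The
    vertices [u] are not adjacent to [c], so they survive; in the end [c] is isolated and the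
    complex is a cone. *)
Lemma fvan_dominated T W c p : c \in W -> c \notin T ->
  (forall y, y \in nbrs c -> y \notin T -> y \in W /\ exists u,
     [/\ u \in W, u \notin T, u \notin nbrs c, ~~ e y u & nbrs u \subset T :|: nbrs y]) ->
  fvan T W p.
Proof.
have [r] := ubnP #|nbrs c :\: T|; elim: r T => [//|r IH] T cr cW cT dom.
have [sub|/subsetPn[y yc yT]] := boolP (nbrs c \subset T);
  first exact: (fvan_cone cW cT sub).
have [yW [u [uW uT uc yu sub]]] := dom y yc yT.
have uy : u != y by apply: contraNneq uc => ->.
apply: (fvan_fold uW uT yW yT uy yu sub); apply: IH => //.
- rewrite ltnS in cr; apply: leq_trans cr; apply: proper_card; apply/properP; split.
    by apply/subsetP => z; rewrite !inE negb_or => /andP[/andP[_ ->]].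
  by exists y; rewrite !inE ?eqxx ?yT //; move: yc; rewrite inE.
- rewrite !inE negb_or cT andbT; apply: contraTneq yc => ->.
  by rewrite inE e_irr.
move=> z zc; rewrite !inE negb_or => /andP[zy zT].
have [zW [w [wW wT wc zw subw]]] := dom z zc zT; split=> //.
exists w; split=> //; last by rewrite -setUA; apply: subset_trans subw _;
  apply: subsetUr.
by rewrite !inE negb_or wT andbT; apply: contraNneq wc => ->.
Qed.

Lemma set_grow_ind (P : {set 'I_n} -> Prop) (S : {set 'I_n}) : P set0 ->
  (forall x (S' : {set 'I_n}), x \in S -> x \notin S' -> S' \subset S ->
    P S' -> P (x |: S')) -> P S.
Proof.
move=> P0 PS; suff H r (S' : {set 'I_n}) : #|S'| = r -> S' \subset S -> P S' by apply: (H #|S|).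
elim: r S' => [|r IH] S'; first by move/cards0_eq->.
move=> cS' sS'; have /set0Pn[x xS'] : S' != set0 by rewrite -card_gt0 cS'.
rewrite -(setD1K xS'); have sub : S' :\ x \subset S by apply: subset_trans sS';
  apply: subD1set.
apply: PS; rewrite ?setD11 //; first exact: (subsetP sS').
by apply: IH => //; apply/eqP; move: cS'; rewrite (cardsD1 x) xS' add1n => -[->].
Qed.

Definition nbrset (S : {set 'I_n}) : {set 'I_n} := [set y | [exists x in S, e x y]].

Lemma nbrset0 : nbrset set0 = set0.
Proof. by apply/setP => y; rewrite !inE; apply/existsP => -[x]; rewrite inE. Qed.

Lemma nbrsetU1 x S : nbrset (x |: S) = nbrset S :|: nbrs x.
Proof.
apply/setP => y; rewrite !inE; apply/existsP/orP => [[z]|[/existsP[z /andP[zS zy]]|xy]].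
- rewrite !inE => /andP[/orP[/eqP->|zS] zy]; [by right|left].
  by apply/existsP; exists z; rewrite zS.
- by exists z; rewrite !inE zS orbT.
- by exists x; rewrite !inE eqxx.
Qed.

(* [Y] is a set of vertices subdividing the edges between [A] and [B], each edge
   at least once. *)
Section SubdividedBiclique.
Variables A B Y : {set 'I_n}.
Hypotheses (A_neq0 : A != set0) (B_neq0 : B != set0) (AB : [disjoint A & B]).
Hypothesis AB_indep : forall x y, x \in A :|: B -> y \in A :|: B -> ~~ e x y.
Hypothesis Y_nbrs : forall y, y \in Y ->
  exists a b, [/\ a \in A, b \in B & nbrs y = [set a; b]].
Hypothesis Y_full : forall a b, a \in A -> b \in B ->
  exists2 y, y \in Y & nbrs y = [set a; b].

Let W0 := A :|: B :|: Y.
(** The vertices removed once the complex is restricted to [W0] and the link at every vertex of [S]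
    is taken. *)
Let around (S : {set 'I_n}) : {set 'I_n} := ~: W0 :|: nbrset S.

Let a_notin_B a : a \in A -> a \notin B.
Proof. by move=> aA; rewrite (disjointFr AB aA). Qed.

Let e_nbrs x y : e x y = (x \in nbrs y).
Proof. by rewrite inE e_sym. Qed.

Let Y_notin y : y \in Y -> y \notin A :|: B.
Proof.
move=> /Y_nbrs[a [b [aA bB yab]]]; apply/negP => yAB.
have := @AB_indep a y; rewrite yAB inE aA => /(_ isT isT).
by rewrite e_nbrs yab !inE eqxx.
Qed.

Let aroundU x S : around (x |: S) = around S :|: nbrs x.
Proof. by rewrite /around nbrsetU1 setUA. Qed.

Let around0 : around set0 = ~: W0.
Proof. by rewrite /around nbrset0 setU0. Qed.

Let AB_notin_around (S : {set 'I_n}) x : S \subset A :|: B -> x \in A :|: B -> x \notin around S.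
Proof.
move=> sS xAB; rewrite !inE negb_or negbK; move: (xAB); rewrite inE => -> /=.
apply/existsPn => z; rewrite negb_and -implybE; apply/implyP => zS.
by apply: AB_indep => //; apply: (subsetP sS).
Qed.

Let Y_notin_around (S : {set 'I_n}) y : y \in Y -> [disjoint nbrs y & S] -> y \notin around S.
Proof.
move=> yY dis; rewrite !inE yY orbT /=; apply/existsPn => z.
rewrite e_nbrs andbC negb_and -implybE; apply/implyP => zy.
by rewrite (disjointFr dis zy).
Qed.

(** Links are taken at all of [A] but [a0], then [a0] is deleted, then links are taken at all of
    [B]. Every link lowers the dimension by one, since the matching deletion is a cone, and
    [#|A| - 1 + #|B|] links lead to the sphere of dimension -1. The degree [p = #|W2|] stays fixed,
    since a link takes one vertex out of [W] instead. *)
Lemma biclique_nonvanishing : exists p, (p + (#|A| + #|B|)).-1 = #|W0| /\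
  ~ kvanish (@mvar k n) (@wt1 n) (wgr (@wt1 n)) (mideal (eset set0)) s p #|W0|%:Z.
Proof.
have /set0Pn[a0 a0A] := A_neq0; have /set0Pn[b0 b0B] := B_neq0.
have a0B := a_notin_B a0A.
pose A1 := A :\ a0; pose W1 := W0 :\: A1; pose W2 := W1 :\: B.
have inA x : x \in A -> x \in A :|: B by rewrite inE => ->.
have inB x : x \in B -> x \in A :|: B by rewrite inE orbC => ->.
have sA1 : A1 \subset A by apply: subD1set.
have sAB (S : {set 'I_n}) : S \subset A -> S \subset A :|: B.
  by move=> sS; apply: subset_trans sS (subsetUl _ _).
have setDU1 x (S : {set 'I_n}) : W0 :\: (x |: S) = (W0 :\: S) :\ x by rewrite setDDl setUC.
have sBW1 : B \subset W1.
  apply/subsetP => b bB; rewrite !inE bB orbT /= andbT negb_and.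
  by rewrite (disjointFl AB bB) orbT.
have cardW : (#|W2| + (#|A| + #|B|)).-1 = #|W0|.
  rewrite -(cardsID A1 W0) (setIidPr _); last first.
    by apply/subsetP => a /(subsetP sA1) aA; rewrite !inE aA.
  rewrite -(cardsID B (W0 :\: A1)) (setIidPr sBW1) (cardsD1 a0 A) a0A.
  by rewrite -/W1 -/W2 -/A1 add1n addSn addnS /= addnC -addnA.
exists #|W2|; split; first exact: cardW.
move/fvan_total => V.
have {}V : fvan (around set0) W0 #|W2|.
  rewrite around0; apply: (@set_grow_ind (fun S => fvan S W0 #|W2|)) => // x S.
  by rewrite inE => xW _ _; apply: fvan_outside.
have {}V : fvan (around A1) W1 #|W2|.
  rewrite /W1; apply: (@set_grow_ind (fun S => fvan (around S) (W0 :\: S) #|W2|)).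
    by rewrite setD0.
  move=> a S aA1 aS sS VS; have sSA : S \subset A := subset_trans sS sA1.
  have aA := subsetP sA1 a aA1; have a_neq0 : a != a0 by move: aA1;
    rewrite !inE => /andP[].
  have a0S : a0 \notin S.
    by apply/negP => /(subsetP sS); rewrite !inE eqxx.
  rewrite aroundU setDU1; apply: fvan_link => //.
  - by rewrite !inE aS aA.
  - by apply: AB_notin_around; [apply: sAB|apply: inA].
  (* Once [a] is deleted, a vertex subdividing [a0]-[b] is dominated by one subdividing [a]-[b],
     whose only remaining neighbour is [b]; hence [a0] can be isolated by folds. *)
  apply: (@fvan_dominated _ _ a0).
  - by rewrite !inE a0S a0A.
  - rewrite in_setU1 negb_or eq_sym a_neq0 /=.
    by apply: AB_notin_around; [apply: sAB|apply: inA].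
  move=> y; rewrite -e_nbrs => ya0; rewrite in_setU1 negb_or => /andP[_ yT].
  have yW0 : y \in W0 by apply: contraR yT => yW; rewrite inE in_setC yW.
  have yY : y \in Y.
    move: yW0; rewrite inE => /orP[yAB|//].
    by have := AB_indep yAB (inA _ a0A); rewrite ya0.
  have [a' [b [a'A bB yab]]] := Y_nbrs yY.
  have ea' : a' = a0.
    have : a0 \in nbrs y by rewrite inE.
    rewrite yab !inE => /orP[/eqP->//|/eqP e0].
    by rewrite -e0 (negPf a0B) in bB.
  have yS : y \notin S.
    by apply: contra (Y_notin yY) => /(subsetP sSA) /inA.
  split; first by rewrite inE yS.
  have [u uY uab] := Y_full aA bB.
  have uS : u \notin S by apply: contra (Y_notin uY) => /(subsetP sSA) /inA.
  have bS : b \notin S by apply/negP => /(subsetP sSA) bA;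
    rewrite (negPf (a_notin_B bA)) in bB.
  exists u; split.
  - by rewrite !inE uS uY orbT.
  - rewrite in_setU1 negb_or; apply/andP; split.
      by apply: contraNneq (Y_notin uY) => ->; apply: inA.
    by apply: Y_notin_around => //; rewrite uab disjoints_subset; apply/subsetP => z;
      rewrite !inE => /orP[/eqP->|/eqP->].
  - apply/negP; rewrite inE e_sym => ua.
    have : a0 \in nbrs u by rewrite inE.
    rewrite uab !inE eq_sym (negPf a_neq0) /= => /eqP e0.
    by rewrite -e0 (negPf a0B) in bB.
  - apply/negP => yu; have : u \in nbrs y by rewrite inE.
    rewrite yab => uab'; have /negP := Y_notin uY; apply.
    by move: uab'; rewrite !inE => /orP[/eqP->|/eqP->]; rewrite ?a'A ?bB ?orbT.
  rewrite uab yab; apply/subsetP => z; rewrite !inE => /orP[->//|->].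
  by rewrite !orbT.
have {}V : fvan (a0 |: around A1) W1 #|W2|.
  (* In the link at [a0] links have been taken at all of [A], so every subdividing vertex is gone
     and [b0] is isolated: the link is a cone. *)
  apply: fvan_del => //.
  - by rewrite !inE eqxx a0A.
  - by apply: AB_notin_around; [apply: sAB|apply: inA].
  have b_neq : b0 != a0 by apply: contraNneq a0B => <-.
  have b0W1 := subsetP sBW1 _ b0B.
  move=> q; rewrite -aroundU; apply: (@fvan_cone _ _ b0).
  - by rewrite in_setD1 b_neq.
  - rewrite setD1K //; apply: AB_notin_around; [exact: sAB|exact: inB].
  rewrite setD1K //; apply/subsetP => y; rewrite -e_nbrs => yb.
  rewrite inE in_setC; have [yW0|//] := boolP (y \in W0); apply/orP; right.
  move: yW0; rewrite inE => /orP[yAB|yY].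
    by have := AB_indep yAB (inB _ b0B); rewrite yb.
  have [a [b [aA bB yab]]] := Y_nbrs yY; rewrite inE; apply/existsP; exists a.
  by rewrite aA e_nbrs yab !inE eqxx.
have {}V : fvan (a0 |: (around A1 :|: nbrset B)) W2 #|W2|.
  rewrite /W2; apply: (@set_grow_ind
    (fun S => fvan (a0 |: (around A1 :|: nbrset S)) (W1 :\: S) #|W2|)).
    by rewrite setD0 nbrset0 setU0.
  move=> b S bB bS sS VS.
  have [u uY uab] := Y_full a0A bB.
  have uA1 : u \notin around A1.
    apply: Y_notin_around => //; rewrite uab disjoints_subset; apply/subsetP => z.
    rewrite !inE => /orP[/eqP->|/eqP->]; first by rewrite eqxx.
    by rewrite negb_and (disjointFl AB bB) orbT.
  have uB : u \notin nbrset S.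
    rewrite inE; apply/existsPn => z; rewrite negb_and -implybE; apply/implyP => zS.
    rewrite e_nbrs uab !inE negb_or; apply/andP; split.
      by apply: contraNneq a0B => <-; apply: (subsetP sS).
    by apply: contraNneq bS => <-.
  have ua0 : u != a0 by apply: contraNneq (Y_notin uY) => ->; apply: inA.
  have ub : u != b by apply: contraNneq (Y_notin uY) => ->; apply: inB.
  have -> : W1 :\: (b |: S) = (W1 :\: S) :\ b by rewrite setDDl setUC.
  have -> : a0 |: (around A1 :|: nbrset (b |: S)) = (a0 |: (around A1 :|: nbrset S)) :|: nbrs b.
    by rewrite nbrsetU1 !setUA.
  apply: fvan_link => //.
  - by rewrite inE bS (subsetP sBW1).
  - rewrite in_setU1 [_ \in _ :|: nbrset S]in_setU !negb_or; apply/and3P; split.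
    + by apply: contraNneq a0B => <-.
    + by apply: AB_notin_around; [apply: sAB|apply: inB].
    rewrite inE; apply/existsPn => z; rewrite negb_and -implybE; apply/implyP => zS.
    by apply: AB_indep; apply: inB; [apply: (subsetP sS)|].
  (* With both [a0] and [b] deleted, the vertex [u] subdividing their edge is isolated. *)
  apply: (@fvan_cone _ _ u).
  - rewrite !inE uY orbT andbT; apply/andP; split.
      by apply: contra (Y_notin uY) => /(subsetP sS); apply: inB.
    by apply/negP => /andP[_ uA]; have /negP := Y_notin uY; apply; apply: inA.
  - by rewrite !in_setU1 [_ \in _ :|: nbrset S]in_setU !negb_or ub ua0 uA1.
  by rewrite uab; apply/subsetP => z; rewrite !inE => /orP[->|->]; rewrite ?orbT.
apply: fvan_killed V; apply/subsetP => x; rewrite inE => /andP[xB].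
rewrite inE => /andP[xA1]; rewrite in_setU => /orP[xAB|xY].
  have xA : x \in A by move: xAB; rewrite inE (negPf xB) orbF.
  by move: xA1; rewrite !inE xA andbT negbK => ->.
have [a [b [aA bB xab]]] := Y_nbrs xY.
rewrite !in_setU; apply/orP; right; apply/orP; right.
by rewrite inE; apply/existsP; exists b; rewrite bB e_nbrs xab !inE eqxx orbT.
Qed.

End SubdividedBiclique.
End Squarefree.

(** * Projective dimension and regularity of graphs *)

Section MonomialInvariants.
Variables (k : fieldType) (n : nat).
Local Notation R := {mpoly k[n]}.
Variables (I : idealr R) (U : pred 'X_{1..n}).
Hypothesis IU : forall p : R, p \in I <-> mideal U p.
Local Notation M := ({ideal_quot I} : lmodType R).
Variable gr : nat -> M -> Prop.
Hypothesis grE : forall d u, gr d u <-> quot_gr (@wt1 n) d%:Z u.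
Local Notation kvan p d :=
  (kvanish (@mvar k n) (@wt1 n) (wgr (@wt1 n)) (mideal U) (enum 'I_n) p d).

Lemma ideal_proper : ~~ U 0%MM.
Proof.
apply/negP => U0; have /idP := idealr1 I; apply.
by apply/IU => m; rewrite msupp1 inE => /eqP->.
Qed.

Lemma quotient_resolution : exists F : min_graded_free_resolution gr, True.
Proof.
pose aug : {linear 'rV[R]_1 -> M} := quot_pi I \o @row_coord k n 1 ord0.
have augE v : aug v = quot_pi I (v 0 0) by [].
apply: (@min_resolution_exists _ _ _ _ aug).
- apply/grE; exists 1; last by rewrite augE mxE.
  by move=> m; rewrite msupp1 inE => /eqP->; rewrite wdeg1 mdeg0.
- move=> u; have [p ->] := quot_pi_surj u; exists (const_mx p).
  by rewrite augE mxE.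
- move=> d v; rewrite !augE => /(quot_pi_eq0 IU) Uv; apply/(quot_pi_eq0 IU) => m.
  rewrite mxE mcoeff_msupp mcoeff_mpick; case: ifP; rewrite ?eqxx // => _.
  by rewrite -mcoeff_msupp; apply: Uv.
- move=> v; rewrite augE => /(quot_pi_eq0 IU) Uv.
  by apply: memN_msupp_eq0; apply/negP => /Uv U0; move: ideal_proper; rewrite U0.
Qed.

Lemma free_projective q : projective ('rV[R]_q : lmodType R).
Proof.
move=> A B f g f_surj.
have /choice[c cP] : forall a, exists x, f x = g (delta_mx 0 a) by move=> a;
  apply: f_surj.
have hlin : linear (fun v : 'rV[R]_q => \sum_a v 0 a *: c a).
  move=> a u v; rewrite scaler_sumr -big_split; apply: eq_bigr => b _.
  by rewrite !mxE scalerDl scalerA.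
pose h : {linear 'rV[R]_q -> A} := HB.pack (fun v : 'rV[R]_q => \sum_a v 0 a *: c a)
  (GRing.isLinear.Build R _ A _ _ hlin).
exists h => v; rewrite linear_sum {2}[v]row_sum_delta linear_sum.
by apply: eq_bigr => a _; rewrite !linearZ /= cP.
Qed.

(** The minimal graded resolution with its grading forgotten is the witness: a generator in position
    [p > d] would contradict [betti_nonvanish]. *)
Lemma proj_dim_le_kvanish d : (forall p j, (d < p)%N -> kvan p j) -> proj_dim_le M d.
Proof.
move=> V; have [F _] := quotient_resolution.
unshelve eexists (@ProjResolution R M (fun p => 'rV[R]_(gf_rank F p) : lmodType R)
  (fun p => mulmxr (gf_diff F p)) (gf_aug F) (fun p => @free_projective _)
  (gf_aug_surj F) (@gf_exact0 _ _ _ _ F) (@gf_exact _ _ _ _ F)).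
move=> p dp x; apply/rowP => a.
by case: (betti_nonvanish IU grE (a := (a : 'I_(gf_rank F p))) (V _ _ dp)).
Qed.

Lemma is_regularity_kvanish (r : nat) :
  (forall p d, ((p + r)%N%:Z < d)%R -> kvan p d) ->
  (exists p, ~ kvan p (p + r)%N%:Z) -> is_regularity gr r%:Z.
Proof.
move=> V [p NV]; split.
  have [F _] := quotient_resolution; exists p, (p + r)%N.
  exists #|[set a : 'I_(gf_rank F p) | gf_deg a == (p + r)%N]|; split.
  - by exists F.
  - move/eqP; rewrite cards_eq0 => /eqP E; apply: NV;
    apply: (betti_vanish IU grE (F := F)).
    by move=> a; apply: contraT; rewrite negbK => ea; rewrite -(in_set0 a) -E inE.
  - by rewrite PoszD addrAC subrr add0r.
move=> i j beta [F ->] /eqP; rewrite cards_eq0 => /set0Pn[a]; rewrite inE => /eqP ja.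
rewrite lerBlDr leNgt; apply/negP => lt_j.
apply: (betti_nonvanish IU grE (a := a)); apply: V.
by rewrite ja PoszD addrC.
Qed.

End MonomialInvariants.

Section Graph.
Variables (k : fieldType) (G : sgraph).
Local Notation n := #|{: G}|.

Definition vrel : rel 'I_n := fun i j => adj (enum_val i : G) (enum_val j).

Lemma vrel_sym : ssrbool.symmetric vrel.
Proof. by move=> i j; apply: adj_sym. Qed.

Lemma vrel_irr : irreflexive vrel.
Proof. by move=> i; apply: adj_irr. Qed.

Lemma edge_idealP (p : {mpoly k[n]}) :
  p \in @edge_ideal k G <-> mideal (eset vrel set0) p.
Proof.
have subE := @submod_mideal k n _ (@eset_upset n vrel set0).
have [E0 _ EZ] := subE.
split=> [/asboolP[c ->]|Ep].
  have big_E (J : finType) (P : pred J) (F : J -> {mpoly k[n]}) :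
    (forall j, P j -> mideal (eset vrel set0) (F j)) ->
    mideal (eset vrel set0) (\sum_(j | P j) F j).
    move=> H; apply: (big_ind (mideal (eset vrel set0)) E0) => // q q'.
    exact: (submod_add subE).
  apply: (big_E) => x _; apply: (big_E) => y xy;
    apply: (EZ (c x y) (vvar k x * vvar k y : {mpoly k[n]})).
  move=> m; rewrite -mpolyXD msuppX inE => /eqP->; apply/esetP; right.
  exists (enum_rank x), (enum_rank y).
  by rewrite /vrel !enum_rankK !mnmDE !mnm1E !eqxx addn1 add1n.
rewrite [p]mpolyE big_seq; apply: rpred_sum => m /Ep/esetP[[v]|[i [j [ij mi mj]]]].
  by rewrite inE.
have ne : i != j by apply: contraTneq ij => ->; rewrite vrel_irr.
have -> : p@_m *: 'X_[m] = (p@_m *: 'X_[m - (U_(i) + U_(j))]) * ('X_i * 'X_j).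
  rewrite -scalerAl -!mpolyXD submK //; apply/mnm_lepP => l.
  rewrite mnmDE !mnm1E; have [<-|_] := eqVneq i l;
    first by rewrite eq_sym (negPf ne) addn0.
  by rewrite add0n; case: eqP => [<-|].
apply: idealMr; apply/asboolP.
exists (fun x y => ((x == enum_val i) && (y == enum_val j))%:R).
rewrite (bigD1 (enum_val i)) //= (bigD1 (enum_val j)) //= !eqxx mul1r /vvar !enum_valK.
rewrite !big1 ?addr0 // => [x /negPf xi|y /andP[_ /negPf yj]]; last by rewrite yj mul0r.
by apply: big1 => y _; rewrite xi mul0r.
Qed.

Lemma edge_quot_grE d (u : edge_quot k G) :
  edge_quot_gr d u <-> quot_gr (@wt1 n) d%:Z (u : {ideal_quot (@edge_ideal k G)}).
Proof.
split=> -[p hp ->]; exists p => //.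
  by move=> m mp; rewrite wdeg1 (dhomog_mf hp).
by apply/dhomogP => m /hp; rewrite wdeg1 => -[].
Qed.

Lemma graph_proj_dim_le : (0 < n)%N -> proj_dim_le (edge_quot k G) n.-1.
Proof.
move=> n_gt0; apply: (proj_dim_le_kvanish edge_idealP edge_quot_grE) => p j np.
apply: eset_kvanish_top; [exact: vrel_sym|exact: vrel_irr| |by rewrite -(prednK n_gt0)].
apply/eqP => /setP/(_ (Ordinal n_gt0)); by rewrite !inE.
Qed.

(** [projectively_prime] asks for the actual value for [G - x], so the least admissible bound is
    taken; only its size is then used. *)
Lemma graph_proj_dim_exists : (0 < n)%N -> exists2 d, graph_proj_dim k G d & (d < n)%N.
Proof.
move=> n_gt0; have ex : exists d, `[< proj_dim_le (edge_quot k G) d >].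
  by exists n.-1; apply/asboolP/graph_proj_dim_le.
have [d /asboolP dP dmin] := ex_minnP ex; exists d.
  by split=> // e' /asboolP; apply: dmin.
rewrite -(prednK n_gt0) ltnS; apply: dmin; exact/asboolP/graph_proj_dim_le.
Qed.

Lemma graph_proj_dim_cut (A : {set 'I_n}) : A != set0 -> A != [set: 'I_n] ->
  (forall a b, a \in A -> b \notin A -> vrel a b) -> graph_proj_dim k G n.-1.
Proof.
move=> A0 AT cut; have n_gt0 : (0 < n)%N.
  by case/set0Pn: A0 => a _; apply: leq_ltn_trans (ltn_ord a).
split; first exact: graph_proj_dim_le.
move=> d dP; rewrite leqNgt; apply/negP => lt_d.
apply: (eset0_join vrel_sym vrel_irr A0 AT cut (k := k)).
exact: (proj_dim_kvanish edge_idealP dP lt_d).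
Qed.

End Graph.

(** * Projective dimension of joins *)

Section JoinGraph.
Variables (G H : sgraph) (k : fieldType).
Hypotheses (G_gt0 : (0 < #|{: G}|)%N) (H_gt0 : (0 < #|{: H}|)%N).
Local Notation K := (join G H).

Lemma card_join : #|{: K}| = (#|{: G}| + #|{: H}|)%N.
Proof. exact: card_sum. Qed.

Lemma connected_join : connected_graph K.
Proof.
have [g0 _] : exists x, x \in {: G} by apply/card_gt0P.
have [h0 _] : exists x, x \in {: H} by apply/card_gt0P.
split; first by rewrite card_join addn_gt0 G_gt0.
have c1 (x y : K) : adj x y -> connect adj x y by apply: connect1.
move=> [x|x] [y|y].
- by apply: connect_trans (c1 (inr h0) (inl y) _); first exact: (c1 (inl x) (inr h0)).
- exact: (c1 (inl x) (inr y)).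
- exact: (c1 (inr x) (inl y)).
- by apply: connect_trans (c1 (inl g0) (inr y) _); first exact: (c1 (inr x) (inl g0)).
Qed.

Lemma join_proj_dim : graph_proj_dim k K #|{: K}|.-1.
Proof.
have [g0 _] : exists x, x \in {: G} by apply/card_gt0P.
have [h0 _] : exists x, x \in {: H} by apply/card_gt0P.
pose inG (x : K) := if x is inl _ then true else false.
apply: (@graph_proj_dim_cut _ _ [set i | inG (enum_val i)]).
- by apply/set0Pn; exists (enum_rank (inl g0 : K)); rewrite inE enum_rankK.
- by apply/eqP => /setP/(_ (enum_rank (inr h0 : K))); rewrite !inE enum_rankK.
by move=> a b; rewrite !inE /vrel; case: (enum_val a) => // x _; case: (enum_val b).
Qed.

Lemma card_del_vertex (x : K) : #|{: del_vertex x}| = #|{: K}|.-1.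
Proof. by rewrite card_sig (eq_card (B := predC1 x)) // cardC1. Qed.

Lemma join_projectively_prime : projectively_prime k K.
Proof.
split; first exact: connected_join.
move=> x; have x_gt0 : (0 < #|{: del_vertex x}|)%N.
  by rewrite card_del_vertex card_join -subn1 subn_gt0 -(prednK G_gt0)
    addSn ltnS addn_gt0 H_gt0 orbT.
have [d dP lt_d] := graph_proj_dim_exists k x_gt0.
exists d, #|{: K}|.-1; split=> //; first exact: join_proj_dim.
by rewrite -(card_del_vertex x).
Qed.

End JoinGraph.

(** * Regularity of subdivided joins *)

Section SubdivisionRegularity.
Variable k : fieldType.

Section UpperBound.
Variable G : sgraph.
Local Notation S := (subdivision G).
Local Notation n := #|{: S}|.

Definition vertex_index (x : G) : 'I_n := enum_rank (inl x : S).
Definition vertex_side : {set 'I_n} := [set vertex_index x | x in G].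

Lemma vertex_index_inj : injective vertex_index.
Proof. by move=> x y /enum_rank_inj[]. Qed.

Lemma vertex_sideP i : (i \in vertex_side) = (if enum_val i is inl _ then true else false).
Proof.
apply/imsetP/idP => [[x _ ->]|]; first by rewrite enum_rankK.
by case e: (enum_val i) => [x|//] _; exists x;
  rewrite // /vertex_index -[inl x]e enum_valK.
Qed.

Lemma card_vertex_side : #|vertex_side| = #|{: G}|.
Proof. by rewrite card_imset //; apply: vertex_index_inj. Qed.

Lemma vertex_side_bip (i j : 'I_n) : vrel i j -> (i \in vertex_side) = (j \notin vertex_side).
Proof. by rewrite /vrel !vertex_sideP;
  case: (enum_val i) (enum_val j) => [x|ed] [y|ed']. Qed.

Lemma subdivision_no_leaf : no_leaf (@vrel S) vertex_side set0.
Proof.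
move=> a b; rewrite vertex_sideP {1 2}/vrel; case ea: (enum_val a) => [x|//] _ _ _.
case eb: (enum_val b) => [//|ed] /= xed.
have /existsP[u /existsP[v /andP[uv /eqP edE]]] := valP ed.
have {}edE : sval ed = [set u; v] := edE.
have uv_neq : u != v by apply: contraTneq uv => ->; rewrite adj_irr.
have [y yx yed] : exists2 y, y != x & y \in sval ed.
  move: xed; rewrite edE => /set2P[->|->].
    by exists v; rewrite ?set22 // eq_sym.
  by exists u; rewrite ?set21.
exists (vertex_index y); first by rewrite -(inj_eq enum_val_inj) ea enum_rankK.
by split; rewrite ?inE ?imset_f //= enum_rankK.
Qed.

Lemma subdivision_reg_le : (0 < #|{: G}|)%N ->
  reg_le k (eset (@vrel S) set0) #|{: G}|.-1.
Proof.
move=> G_gt0; apply: (reg_le_no_leaf (@vrel_sym S) (@vrel_irr S) vertex_side_bip).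
  exact: subdivision_no_leaf.
rewrite prednK // -card_vertex_side subset_leq_card //.
by apply/subsetP => i; rewrite inE => /andP[]; rewrite setD0.
Qed.

End UpperBound.

Section LowerBound.
Variables G H : sgraph.
Hypotheses (G_gt0 : (0 < #|{: G}|)%N) (H_gt0 : (0 < #|{: H}|)%N).
Local Notation K := (join G H).
Local Notation S := (subdivision K).
Local Notation n := #|{: S}|.
Local Notation ix := (@vertex_index K).

Let A : {set 'I_n} := [set ix (inl g) | g in G].
Let B : {set 'I_n} := [set ix (inr h) | h in H].
Let subdivides (i : 'I_n) (g : G) (h : H) : bool :=
  if enum_val i is inr ed then val ed == [set inl g; inr h] :> {set K} else false.
Let Y : {set 'I_n} := [set i | [exists g, exists h, subdivides i g h]].

Let Y_nbrs i g h : subdivides i g h ->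
  nbrs (@vrel S) i = [set ix (inl g); ix (inr h)].
Proof.
rewrite /subdivides; case ei: (enum_val i) => [//|ed] /eqP edE; apply/setP => j.
rewrite !inE /vrel ei; case ej: (enum_val j) => [x|ed'] /=; last first.
  by apply/esym/negbTE; rewrite negb_or; apply/andP; split;
    apply/eqP => e; move: ej; rewrite e enum_rankK.
have {}edE : sval ed = [set inl g; inr h] := edE.
have -> : j = ix x by rewrite /vertex_index -ej enum_valK.
by rewrite edE !inE !(inj_eq (@vertex_index_inj K)).
Qed.

Lemma subdivision_join_nonvanishing : exists p,
  ~ kvanish (@mvar k n) (@wt1 n) (wgr (@wt1 n)) (mideal (eset (@vrel S) set0)) (enum 'I_n)
      p (p + #|{: K}|.-1)%N%:Z.
Proof.
have [g0 _] : exists x, x \in {: G} by apply/card_gt0P.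
have [h0 _] : exists x, x \in {: H} by apply/card_gt0P.
have cA : #|A| = #|{: G}| by rewrite card_imset // => x y /vertex_index_inj[].
have cB : #|B| = #|{: H}| by rewrite card_imset // => x y /vertex_index_inj[].
have sAB x : x \in A :|: B -> x \in vertex_side K.
  by rewrite inE => /orP[]/imsetP[z _ ->]; apply: imset_f.
have [||||||p [pE NV]] := @biclique_nonvanishing k n (@vrel S) (@vrel_sym S) (@vrel_irr S) A B Y.
- by apply/set0Pn; exists (ix (inl g0)); apply: imset_f.
- by apply/set0Pn; exists (ix (inr h0)); apply: imset_f.
- rewrite -setI_eq0; apply/eqP/setP => x; rewrite !inE; apply/negP => /andP[].
  by case/imsetP=> g _ ->; case/imsetP=> h _ /vertex_index_inj.
- move=> x y /sAB xV /sAB yV; apply/negP => /(@vertex_side_bip K).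
  by rewrite xV yV.
- move=> y; rewrite inE => /existsP[g /existsP[h yP]].
  by exists (ix (inl g)), (ix (inr h)); split;
    [apply: imset_f|apply: imset_f|apply: Y_nbrs].
- move=> _ _ /imsetP[g _ ->] /imsetP[h _ ->].
  have ed : is_edge [set (inl g : K); inr h].
    by apply/existsP; exists (inl g); apply/existsP; exists (inr h); rewrite eqxx.
  pose y : 'I_n := enum_rank (inr (exist (fun f : {set K} => is_edge f) _ ed) : S).
  have yP : subdivides y g h by rewrite /subdivides enum_rankK /=.
  exists y; last exact: (Y_nbrs yP).
  by rewrite inE; apply/existsP; exists g; apply/existsP; exists h.
(* Writing [#|{: G}|] as a successor turns the predecessor of the sum in [pE] into
   [p + #|{: K}|.-1]. *)
exists p; rewrite -(prednK G_gt0) in cA; move: NV.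
by rewrite -pE cA cB card_join -(prednK G_gt0) addSn addnS.
Qed.

Lemma subdivision_join_reg : graph_reg k S #|{: K}|.-1%:Z.
Proof.
apply: (is_regularity_kvanish (@edge_idealP k S) (@edge_quot_grE k S)).
  by move=> p d; apply: subdivision_reg_le; rewrite card_join addn_gt0 G_gt0.
exact: subdivision_join_nonvanishing.
Qed.

End LowerBound.
End SubdivisionRegularity.

Theorem proposition5p2 (G H : sgraph)
    (hG : (0 < #|{: G}|)%N) (hH : (0 < #|{: H}|)%N) :
  perfect_projectively_prime (join G H) /\
  forall k : fieldType,
    graph_proj_dim k (join G H) (#|{: G}| + #|{: H}| - 1)%N /\
    graph_reg k (subdivision (join G H)) (#|{: G}| + #|{: H}| - 1)%N%:Z.
Proof.
split=> k; first exact: join_projectively_prime.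
by rewrite subn1 -card_join; split; [apply: join_proj_dim|apply: subdivision_join_reg].
Qed.
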